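(* Fix an integer $d\ge 2$. For the random recursive $d$-DAG process with descendant sets $D_n$, we have, as $n\to\infty$, $$n^{-\frac{d-1}{d}}\,\mathbb{E}\,|D_n\cap D_{n+1}| \;\longrightarrow\; \frac{(d-1)^{1/d}\,\pi}{d\,\sin(\pi/d)}\left[\frac{2\,\Gamma\!\left(\frac{d}{d-1}+\frac1d\right)}{\Gamma\!\left(\frac{d}{d-1}\right)}-\frac{\Gamma\!\left(\frac{2d}{d-1}+\frac1d\right)}{\Gamma\!\left(\frac{2d}{d-1}\right)}\right].$$
   Context: Write $[n]=\{1,\dots,n\}$. Random recursive $d$-DAG process: the vertices are $1,2,3,\dots$; each vertex $j\ge 2$ has exactly $d$ outgoing arrows, whose targets are chosen independently and uniformly at random from $[j-1]$ (with replacement, so multiple arrows are allowed), independently of the choices at all other vertices. $G_n$ is the directed acyclic (multi)graph on $[n]$ formed by the arrows starting in $2,\dots,n$; all $G_n$ are coupled in this way, so $G_n$ is the restriction of $G_{n+1}$ to $[n]$. Write $i\stackrel{*}{\longrightarrow} j$ if $j$ can be reached from $i$ by a directed path (possibly of length $0$, so $i\stackrel{*}{\longrightarrow} i$). The set of descendants of $n$ is $D_n=\{j\in[n]: n\stackrel{*}{\longrightarrow} j\}$. $\Gamma$ is the Gamma function. *)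

(* Defs.v *)
From mathcomp Require Import all_boot all_order all_algebra finmap.
From mathcomp Require Import all_classical all_reals all_analysis.
Import Order.TTheory GRing.Theory Num.Theory.
Import numFieldNormedType.Exports.

Set Implicit Arguments.
Unset Strict Implicit.
Unset Printing Implicit Defensive.

Local Open Scope classical_set_scope.
Local Open Scope ring_scope.

(* [g j k] is the target of the [k]-th arrow out of vertex [j].  Only the values
   at [j >= 2] are used: vertex 1 has no outgoing arrow, and 0 is not a vertex. *)
Definition arrow (d : nat) (g : nat -> 'I_d -> nat) : rel nat :=
  fun i j => (2 <= i)%N && [exists k : 'I_d, g i k == j].

Definition reaches (d : nat) (g : nat -> 'I_d -> nat) (i j : nat) : Prop :=
  exists2 p : seq nat, path (arrow g) i p & last i p = j.

Definition descendants (d : nat) (g : nat -> 'I_d -> nat) (n : nat) :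
    {fset nat} :=
  [fset j in iota 1 n | `[< reaches g n j >]]%fset.

Definition mutually_independent (d : measure_display) (T : measurableType d)
    (R : realType) (P : probability T R) (I : choiceType) (A : set I)
    (d' : measure_display) (T' : measurableType d') (X : I -> {RV P >-> T'}) :
    Prop :=
  forall (J : {fset I}) (B : I -> set T'),
    [set` J] `<=` A -> (forall i, measurable (B i)) ->
    P (\bigcap_(i in [set` J]) (X i @^-1` B i)) =
    (\prod_(i <- J) P (X i @^-1` B i))%E.

(* The whole sequence of graphs is encoded by one family of random targets, so
   the graphs on [n] and on [n+1] are coupled by restriction.  The index [(j, k)]
   stands for the [k]-th arrow out of vertex [j]. *)
Record random_recursive_dag (dT : measure_display) (T : measurableType dT)
    (R : realType) (P : probability T R) (d : nat)
    (X : nat * 'I_d -> {RV P >-> nat}) : Prop := RandomRecursiveDag {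
  target_range : forall j k t, (2 <= j)%N -> (1 <= X (j, k) t <= j.-1)%N;
  target_uniform : forall j k i, (2 <= j)%N -> (1 <= i <= j.-1)%N ->
    P (X (j, k) @^-1` [set i]) = (j.-1%:R^-1)%:E;
  target_independent : mutually_independent [set jk | (2 <= jk.1)%N] X }.

(* Euler's integral; this is the Gamma function for [0 < x] only. *)
Definition Gamma (R : realType) (x : R) : R :=
  \int[lebesgue_measure]_(t in `]0, +oo[) (t `^ (x - 1) * expR (- t)).

(* Main.v *)
Require Import Defs.
From mathcomp Require Import all_boot all_order all_algebra finmap.
From mathcomp Require Import all_classical all_reals all_analysis.
From mathcomp Require Import ring lra measurable_realfun.
Import Order.TTheory GRing.Theory Num.Theory.
Import numFieldNormedType.Exports.

(* Fix m and let A_k be the number of vertices i <= k with i -*-> m.  Given the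
   graph on [k], the vertex k+1 reaches m unless its d arrows all miss these A_k
   vertices, so A is a Markov chain started from A_m = 1 which jumps from a to
   a+1 at time k with probability 1 - (1 - a/k)^d, and
     P(m in D_n and m in D_(n+1)) = E (1 - b^d)^2 + O(1/n),  b := 1 - A_n/n.
   Write e := d-1.  Up to time k = n/q, the function (k^d/(k^d + c))^A_k is
   almost a martingale (A behaves like a Yule process of rate d); after that
   time exp (- g n^e (B^-e - k^-e)) with B := k - A_k is one (A/k follows an
   ODE).  The two match when c = g e n^e, whence the Laplace transform
     E exp (- g (b^-e - 1)) ~ m^d / (m^d + g e n^e).
   Mixing over g with the Gamma(D/e) density turns the left-hand side into
   E b^D, for D = d and D = 2d.  Summing over m gives a Riemann sum of
   1/(1 + x^d), whose integral pi / (d sin (pi/d)) is computed from an explicit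
   primitive, and dominated convergence in g yields the Gamma quotients. *)

Set Implicit Arguments.
Unset Strict Implicit.
Unset Printing Implicit Defensive.

Local Open Scope classical_set_scope.
Local Open Scope ring_scope.

(** * The integral of 1/(1 + x^d) *)

(** Why two regimes, and why they meet at n/q: the Yule approximation errs by O(A_k / k^2) at step
    k. Since E A_k is at most (k/m)^d, this adds up to O(k^e / m^d) by time k, which for k = n is as
    large as the main term c / m^d. Stopping at k = n/q gains a factor q^-e. The flow errs by O(1/n)
    in total, but only while k is of order n, and with a constant that grows with q. Hence n tends
    to infinity before q does. For small m the bound C (n/q)^e / m^d exceeds 1. Cut off at 1, its
    sum over m is of order (n/q)^(e/d), smaller than the main term by a factor q^(-e/d). For this
    reason one Riemann sum, that of y / (m^d + y), yields the limit, the errors and the domination.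
    The exponential of the first integral is used because for A_k much smaller than k it becomes a
    power s^(A_k), and on such powers the Yule process acts in closed form. *)

Section TrigSums.
Variables (R : realType) (d : nat).
Hypothesis d_gt1 : (1 < d)%N.

(** For these angles t, exp(i t) runs through the roots of x^d = -1. *)
Definition root_angle (k : nat) : R := (2 * k%:R + 1) * (pi / d%:R).

Let d_gt0 : 0 < d%:R :> R.
Proof. by rewrite ltr0n (ltn_trans _ d_gt1). Qed.

Lemma sin_int_pi (j : nat) : sin (j%:R * pi) = 0 :> R.
Proof.
elim: j => [|j IH]; first by rewrite mul0r sin0.
by rewrite -natr1 mulrDl mul1r sinDpi IH oppr0.
Qed.

Lemma cos_2int_pi (j : nat) : cos ((2 * j)%:R * pi) = 1 :> R.
Proof.
elim: j => [|j IH]; first by rewrite mul0r cos0.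
rewrite mulnS natrD mulrDl addrC (mulr_natl pi 2).
by rewrite cosD2pi.
Qed.

Lemma sin_piM_gt0 (j : nat) : (0 < j < d)%N -> 0 < sin (j%:R * (pi / d%:R)) :> R.
Proof.
move=> /andP[j0 jd]; apply: sin_gt0_pi.
have p0 := pi_gt0 R; apply/andP; split.
  by rewrite mulr_gt0 ?ltr0n// divr_gt0.
by rewrite mulrA ltr_pdivrMr// mulrC ltr_pM2l// ltr_nat.
Qed.

(** Multiplied by 2 sin(a), a = j pi / d, each term becomes sin((2k+2) a) - sin(2k a), and the sum
    telescopes to sin(2 j pi) = 0. The two companion sums below are treated in the same way. *)
Lemma sum_cos_root_angle (j : nat) : (0 < j < d)%N ->
  \sum_(k < d) cos (j%:R * root_angle k) = 0.
Proof.
move=> jd; have s0 := sin_piM_gt0 jd.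
apply: (@mulfI _ (2 * sin (j%:R * (pi / d%:R)))).
  by rewrite mulf_neq0 ?pnatr_eq0// gt_eqF.
rewrite mulr0 mulr_sumr.
pose u k := sin ((2 * k%:R) * (j%:R * (pi / d%:R))) : R.
rewrite (eq_bigr (fun k : 'I_d => u k.+1 - u k)) => [|k _].
  rewrite -(big_mkord xpredT (fun k => u k.+1 - u k)) telescope_sumr// /u.
  rewrite mulr0 mul0r sin0 subr0.
  rewrite (_ : 2 * _ * _ = (2 * j)%:R * pi) ?sin_int_pi//.
  by rewrite natrM; field; rewrite gt_eqF.
rewrite /u /root_angle.
set a := j%:R * (pi / d%:R).
rewrite (_ : 2 * k.+1%:R * a = (2 * k%:R + 1) * a + a); last by rewrite -natr1; ring.
rewrite (_ : 2 * k%:R * a = (2 * k%:R + 1) * a - a); last by ring.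
rewrite (_ : j%:R * _ = (2 * k%:R + 1) * a); last by rewrite /a; ring.
by rewrite sinD sinB; ring.
Qed.

Lemma sum_sin_root_angle : \sum_(k < d) sin (root_angle k) = 0.
Proof.
have s0 := @sin_piM_gt0 1 d_gt1.
apply: (@mulfI _ (2 * sin (1%:R * (pi / d%:R)))).
  by rewrite mulf_neq0 ?pnatr_eq0// gt_eqF.
rewrite mulr0 mulr_sumr mul1r.
set a := pi / d%:R.
pose u k := cos ((2 * k%:R) * a) : R.
rewrite (eq_bigr (fun k : 'I_d => - (u k.+1 - u k))) => [|k _].
  rewrite sumrN -(big_mkord xpredT (fun k => u k.+1 - u k)) telescope_sumr// /u.
  rewrite mulr0 mul0r cos0.
  rewrite (_ : 2 * _ * _ = (2 * 1)%:R * pi) ?cos_2int_pi ?subrr ?oppr0//.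
  by rewrite natrM /a; field; rewrite gt_eqF.
rewrite /u /root_angle -/a.
rewrite (_ : 2 * k.+1%:R * a = (2 * k%:R + 1) * a + a); last by rewrite -natr1; ring.
rewrite (_ : 2 * k%:R * a = (2 * k%:R + 1) * a - a); last by ring.
by rewrite cosD cosB; ring.
Qed.

Lemma sum_cos_even : \sum_(k < d) cos (2 * k%:R * (pi / d%:R)) = 0 :> R.
Proof.
have s0 := @sin_piM_gt0 1 d_gt1.
apply: (@mulfI _ (2 * sin (1%:R * (pi / d%:R)))).
  by rewrite mulf_neq0 ?pnatr_eq0// gt_eqF.
rewrite mulr0 mulr_sumr mul1r.
set a := pi / d%:R.
pose u k := sin ((2 * k%:R - 1) * a) : R.
rewrite (eq_bigr (fun k : 'I_d => u k.+1 - u k)) => [|k _].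
  rewrite -(big_mkord xpredT (fun k => u k.+1 - u k)) telescope_sumr// /u.
  rewrite mulr0 sub0r mulN1r sinN opprK.
  rewrite (_ : (2 * d%:R - 1) * a = - a + pi *+ 2).
    by rewrite sinD2pi sinN addNr.
  by rewrite /a -mulr_natl; field; rewrite gt_eqF.
rewrite /u.
rewrite (_ : (2 * k.+1%:R - 1) * a = (2 * k%:R) * a + a); last by rewrite -natr1; ring.
rewrite (_ : (2 * k%:R - 1) * a = (2 * k%:R) * a - a); last by ring.
by rewrite sinD sinB; ring.
Qed.

Lemma sum_natM_subr (u : nat -> R) (n : nat) :
  \sum_(k < n) k%:R * (u k - u k.+1) = \sum_(k < n) u k - u 0 - (n%:R - 1) * u n.
Proof.
elim: n => [|n IH]; first by rewrite !big_ord0; ring.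
by rewrite !big_ord_recr/= IH -natr1; ring.
Qed.

(** Multiplying by 2 sin(pi/d) turns each sine into a difference of cosines. Abel summation leaves a
    vanishing sum of cosines and the boundary terms -1 - (d - 1) = -d. *)
Lemma sum_natM_sin_root_angle :
  \sum_(k < d) k%:R * sin (root_angle k) = - (d%:R / (2 * sin (pi / d%:R))).
Proof.
have s0 := @sin_piM_gt0 1 d_gt1; rewrite mul1r in s0.
apply: (@mulfI _ (2 * sin (pi / d%:R))).
  by rewrite mulf_neq0 ?pnatr_eq0// gt_eqF.
rewrite mulrN (mulrC _ (_ / _)) divfK; last first.
  by rewrite mulf_neq0 ?pnatr_eq0// gt_eqF.
set a := pi / d%:R.
pose u k := cos ((2 * k%:R) * a) : R.
rewrite mulr_sumr (eq_bigr (fun k : 'I_d => k%:R * (u k - u k.+1))) => [|k _].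
  rewrite sum_natM_subr sum_cos_even /u mulr0 mul0r cos0.
  rewrite (_ : 2 * d%:R * a = (2 * 1)%:R * pi) ?cos_2int_pi.
    by ring.
  by rewrite natrM /a; field; rewrite gt_eqF.
rewrite /u /root_angle -/a.
rewrite (_ : 2 * k.+1%:R * a = (2 * k%:R + 1) * a + a); last by rewrite -natr1; ring.
rewrite (_ : 2 * k%:R * a = (2 * k%:R + 1) * a - a); last by ring.
by rewrite cosB cosD; ring.
Qed.

(** This is d times the increment of the primitive below from 0 to infinity: the arctangent that
    belongs to the angle t contributes pi - t with weight sin t. *)
Lemma sum_piB_root_angle :
  \sum_(k < d) sin (root_angle k) * (pi - root_angle k) = pi / sin (pi / d%:R).
Proof.
have s0 := @sin_piM_gt0 1 d_gt1; rewrite mul1r in s0.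
rewrite (eq_bigr (fun k : 'I_d => (pi - pi / d%:R) * sin (root_angle k)
    - 2 * (pi / d%:R) * (k%:R * sin (root_angle k)))) => [|k _].
  rewrite sumrB -!mulr_sumr sum_sin_root_angle sum_natM_sin_root_angle.
  by field; rewrite !gt_eqF.
by rewrite {2}/root_angle; ring.
Qed.

End TrigSums.

(** * A primitive of 1/(1 + x^d) by partial fractions *)

Section Primitive.
Variables (R : realType) (d : nat).
Hypothesis d_gt1 : (1 < d)%N.

Let d_gt0 : 0 < d%:R :> R.
Proof. by rewrite ltr0n (ltn_trans _ d_gt1). Qed.

Notation t := (@root_angle R d).
(** The squared modulus of x - exp(i t), t being the k-th angle. *)
Let q (k : nat) (x : R) := 1 - 2 * x * cos (t k) + x ^+ 2.

Lemma root_angle_bound (k : 'I_d) : 0 < t k < 2 * pi.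
Proof.
have p0 := pi_gt0 R; apply/andP; split.
  by rewrite mulr_gt0 ?divr_gt0// ltr_wpDl// mulr_ge0.
rewrite /root_angle mulrA ltr_pdivrMr// mulrAC ltr_pM2r//.
have : (k.+1%:R <= d%:R :> R) by rewrite ler_nat.
by rewrite -natr1; lra.
Qed.

Lemma cos_root_angle_lt1 (k : 'I_d) : cos (t k) < 1.
Proof.
have /andP[t0 t2] := root_angle_bound k.
rewrite (_ : t k = t k / 2 + t k / 2); last by field.
rewrite cosD -!expr2 cos2sin2.
have : 0 < sin (t k / 2) by apply: sin_gt0_pi; apply/andP; split; lra.
by move=> s0; have := exprn_gt0 2 s0; lra.
Qed.

Lemma root_quadratic_gt0 (k : 'I_d) (x : R) : 0 <= x -> 0 < q k x.
Proof.
move=> x0; have c1 := cos_root_angle_lt1 k; rewrite /q.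
have [->|xn0] := eqVneq x 0; first by rewrite mulr0 mul0r expr0n /=; lra.
have xp : 0 < x by rewrite lt_neqAle eq_sym xn0.
rewrite (_ : _ + _ = (1 - x) ^+ 2 + 2 * (x * (1 - cos (t k)))); last by ring.
by rewrite ltr_wpDl ?sqr_ge0// !mulr_gt0// subr_gt0.
Qed.

(* For N = d - 1 the right-hand side is (1 - x cos t) (1 + x^d). *)
Lemma root_quadratic_geom (k N : nat) (x : R) :
  q k x * \sum_(j < N.+1) x ^+ j * cos (j%:R * t k) =
  1 - x * cos (t k) - x ^+ N.+1 * cos (N.+1%:R * t k) + x ^+ N.+2 * cos (N%:R * t k).
Proof.
elim: N => [|N IH].
  by rewrite big_ord1 expr0 !mul0r cos0 !mul1r /q; ring.
rewrite big_ord_recr/= mulrDr IH /q.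
rewrite (_ : N.+2%:R * t k = N.+1%:R * t k + t k); last by rewrite -[N.+2%:R]natr1 mulrDl mul1r.
rewrite (_ : N%:R * t k = N.+1%:R * t k - t k); last by rewrite -natr1 mulrDl mul1r addrK.
by rewrite cosB cosD !exprS; ring.
Qed.

(** Real parts of a geometric series: (1 - x cos t) / q is the real part of 1 / (1 - x exp(i t)),
    which is the sum of x^j exp(i j t) over j < d divided by 1 + x^d, because exp(i d t) = -1.
    Summed over the roots, only j = 0 survives. *)
Lemma sum_root_quadratic (x : R) : 0 <= x ->
  \sum_(k < d) (1 - x * cos (t k)) / q k x = d%:R / (1 + x ^+ d).
Proof.
move=> x0; have xd : 0 < 1 + x ^+ d by rewrite ltr_wpDr// exprn_ge0.
transitivity (\sum_(k < d) (\sum_(j < d) x ^+ j * cos (j%:R * t k)) / (1 + x ^+ d)).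
  apply: eq_bigr => k _.
  have q0 := root_quadratic_gt0 k x0.
  apply/eqP; rewrite eqr_div ?lt0r_neq0//; apply/eqP; rewrite [RHS]mulrC.
  have -> : \sum_(j < d) x ^+ j * cos (j%:R * t k) =
      \sum_(j < d.-1.+1) x ^+ j * cos (j%:R * t k).
    by rewrite prednK// (ltn_trans _ d_gt1).
  rewrite root_quadratic_geom prednK ?(ltn_trans _ d_gt1)//.
  have dt : d%:R * t k = pi + (2 * k)%:R * pi.
    by rewrite /root_angle natrM; field; rewrite gt_eqF.
  have -> : cos (d%:R * t k) = -1.
    by rewrite dt cosD cos_2int_pi sin_int_pi cospi; ring.
  rewrite (_ : d.-1%:R * t k = d%:R * t k - t k); last first.
    by rewrite -subn1 natrB ?(ltnW d_gt1)// mulrBl mul1r.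
  rewrite cosB dt cosD sinD cos_2int_pi sin_int_pi cospi sinpi.
  by rewrite exprS; ring.
rewrite -mulr_suml exchange_big/=; congr (_ / _).
rewrite (bigD1 (Ordinal (ltn_trans (ltn0Sn 0) d_gt1)))//= [X in _ + X]big1 ?addr0.
  rewrite (eq_bigr (fun=> 1)) ?sumr_const ?card_ord// => k _.
  by rewrite expr0 mul0r cos0 mulr1.
move=> j j0; rewrite -mulr_sumr sum_cos_root_angle ?mulr0//.
by rewrite ltn_ord andbT lt0n -(inj_eq val_inj) /= in j0 *.
Qed.

(** The partial fractions integrated one by one. If d is odd, one angle is pi; its arctangent term
    then divides by sin t = 0, and the factor sin t removes it. *)
Definition root_primitive (x : R) : R :=
  d%:R^-1 * \sum_(k < d) (- (cos (t k) / 2) * ln (q k x)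
    + sin (t k) * atan ((x - cos (t k)) / sin (t k))).

Lemma is_derive_root_primitive (x : R) : 0 <= x ->
  is_derive x 1 root_primitive (1 + x ^+ d)^-1.
Proof.
move=> x0.
pose h (k : 'I_d) (x : R) : R := - (cos (t k) / 2) * ln (q k x)
    + sin (t k) * atan ((x - cos (t k)) / sin (t k)).
have dh (k : 'I_d) : is_derive x 1 (h k) ((1 - x * cos (t k)) / q k x).
  have q0 := root_quadratic_gt0 k x0.
  have dq : is_derive x 1 (q k) (2 * x - 2 * cos (t k)).
    rewrite /q; apply: is_derive_eq.
    by rewrite /GRing.scale/=; ring.
  have dl : is_derive x 1 (fun x => ln (q k x)) ((q k x)^-1 * (2 * x - 2 * cos (t k))).
    by apply: is_derive1_comp; exact: is_derive1_ln.
  have da : is_derive x 1 (fun x => atan ((x - cos (t k)) / sin (t k)))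
     ((1 + ((x - cos (t k)) / sin (t k)) ^+ 2)^-1 * (sin (t k))^-1).
    apply: (@is_derive1_comp _ atan (fun x => (x - cos (t k)) / sin (t k))).
    apply: is_derive_eq.
    by rewrite /GRing.scale/=; ring.
  rewrite /h; apply: is_derive_eq.
  rewrite /GRing.scale/=.
  have c2 := cos2Dsin2 (t k).
  have [s0|s0] := eqVneq (sin (t k)) 0.
    have cN1 : cos (t k) = -1.
      have /eqP := c2; rewrite s0 expr0n addr0 sqrf_eq1 => /orP[/eqP c1|/eqP//].
      by have := cos_root_angle_lt1 k; rewrite c1 ltxx.
    have -> : q k x = (1 + x) ^+ 2 by rewrite /q cN1; ring.
    rewrite s0 mul0r addr0 cN1; field.
    by rewrite lt0r_neq0// ltr_wpDr.
  have -> : 1 + ((x - cos (t k)) / sin (t k)) ^+ 2 = q k x / sin (t k) ^+ 2.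
    rewrite /q; apply: (@mulIf _ (sin (t k) ^+ 2)); first by rewrite expf_neq0.
    rewrite divfK ?expf_neq0// mulrDl expr_div_n divfK ?expf_neq0// mul1r.
    rewrite (_ : 1 - _ + _ = cos (t k) ^+ 2 + sin (t k) ^+ 2 - 2 * x * cos (t k) + x ^+ 2).
      by ring.
    by rewrite c2.
  rewrite (_ : (1 - x * cos (t k)) = (cos (t k) ^+ 2 + sin (t k) ^+ 2 - x * cos (t k))).
    by field; rewrite s0 gt_eqF.
  by rewrite c2.
have -> : root_primitive = (fun x => d%:R^-1 * (\sum_(k < d) h k) x).
  by apply/funext => y; rewrite /root_primitive fct_sumE.
apply: is_derive_eq.
by rewrite /GRing.scale/= sum_root_quadratic// mulrA mulVf ?mul1r// gt_eqF.
Qed.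

(** The limit at infinity minus the value at 0 of one arctangent term. For 0 < t < pi, - cos t / sin
    t is the tangent of t - pi/2; beyond pi the angle is shifted by pi, and at pi both sides
    vanish. *)
Lemma root_primitive_term_bounds (k : 'I_d) :
  `|sin (t k)| * (pi / 2) - sin (t k) * atan (- cos (t k) / sin (t k)) =
  sin (t k) * (pi - t k).
Proof.
have p0 := pi_gt0 R; have /andP[t0 t2] := root_angle_bound k.
have atanE (y : R) : 0 < y < pi -> 0 < sin y /\ atan (- cos y / sin y) = y - pi / 2.
  move=> /andP[y0 yp]; have s0 : 0 < sin y by rewrite sin_gt0_pi ?y0.
  split => //; rewrite -[RHS]tanK; last by rewrite in_itv/=; apply/andP; split; lra.
  by rewrite /tan sinBpihalf cosBpihalf.
have [tp|tp|tp] := ltgtP (t k) pi.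
- have [|s0 ->] := atanE (t k); first by rewrite t0.
  by rewrite gtr0_norm//; field.
- have [|s0] := atanE (t k - pi); first by apply/andP; split; lra.
  have := sinDpi (t k - pi); rewrite subrK => ->.
  have := cosDpi (t k - pi); rewrite subrK => ->.
  by rewrite opprK invrN mulrN -mulNr => ->; rewrite normrN gtr0_norm//; field.
by rewrite tp sinpi normr0 !mul0r subrr.
Qed.

Definition root_integral : R := pi / (d%:R * sin (pi / d%:R)).

Lemma root_primitive_cvg : root_primitive x @[x --> +oo] --> root_primitive 0 + root_integral.
Proof.
pose a (k : 'I_d) := - (cos (t k) / 2).
have suma : \sum_(k < d) a k = 0.
  rewrite /a sumrN -mulr_suml (_ : \sum_(k < d) _ = 0) ?mul0r ?oppr0//.
  by rewrite -[RHS](@sum_cos_root_angle R d d_gt1 1)//; under [RHS]eq_bigr do rewrite mul1r.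
(* ln q diverges, but the weights [a k] sum to 0, so it may be replaced by ln (q / x^2), which tends
   to 0. *)
pose G (k : 'I_d) (x : R) := a k * ln (1 - 2 * cos (t k) * x^-1 + x^-1 * x^-1)
   + sin (t k) * atan ((x - cos (t k)) / sin (t k)).
have GE : {near +oo, (fun x => d%:R^-1 * \sum_(k < d) G k x) =1 root_primitive}.
  near=> x; have x0 : 0 < x by near: x; exact: nbhs_pinfty_gt.
  rewrite /root_primitive; congr (_ * _).
  transitivity (\sum_(k < d) (a k * (ln (q k x) - ln (x ^+ 2)) +
     sin (t k) * atan ((x - cos (t k)) / sin (t k)))).
    apply: eq_bigr => k _; rewrite /G; congr (_ * _ + _).
    have q0 := root_quadratic_gt0 k (ltW x0).
    rewrite -ln_div ?posrE ?exprn_gt0//; congr ln.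
    by rewrite /q; field; rewrite gt_eqF.
  under eq_bigr do rewrite mulrBr addrAC.
  by rewrite sumrB -mulr_suml suma mul0r subr0.
have -> : root_primitive 0 + root_integral =
    d%:R^-1 * \sum_(k < d) (a k * 0 + `|sin (t k)| * (pi / 2)).
  have -> : root_integral = d%:R^-1 *
      (\sum_(k < d) `|sin (t k)| * (pi / 2) - \sum_(k < d) sin (t k) * atan (- cos (t k) / sin (t k))).
    rewrite -sumrB (eq_bigr _ (fun k _ => root_primitive_term_bounds k)).
    by rewrite sum_piB_root_angle// /root_integral invfM mulrCA.
  rewrite /root_primitive -mulrDr big_split/= big_split/= -[in LHS]addrA; congr (_ * (_ + _)).
    by apply: eq_bigr => k _; rewrite /q mulr0 mul0r subr0 expr0n addr0 ln1.
  under eq_bigr do rewrite sub0r.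
  by rewrite addrC subrK.
have xV : (x : R)^-1 @[x --> +oo] --> (0 : R).
  by apply/gtr0_cvgV0; [exact: nbhs_pinfty_gt|exact: cvg_id].
apply: cvg_trans (near_eq_cvg GE) _.
apply: cvgMl_tmp; apply: cvg_big => [|k _]; first exact: add_continuous.
apply: cvgD.
  apply: cvgMl_tmp.
  rewrite -[X in _ --> X](@ln1 R).
  have : 1 - 2 * cos (t k) * x^-1 + x^-1 * x^-1 @[x --> +oo] --> (1 - 2 * cos (t k) * 0 + 0 * 0 : R).
    by apply: cvgD; [apply: cvgB; [exact: cvg_cst|exact: cvgMl_tmp]|exact: cvgM].
  rewrite !mulr0 subr0 addr0 => /cvg_comp; apply.
  exact: continuous_ln.
have [s0|s0|s0] := ltgtP (sin (t k)) 0.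
- rewrite ltr0_norm// mulNr -mulrN; apply: cvgMl_tmp.
  have E : (fun x => - atan ((- sin (t k))^-1 * (x - cos (t k)))) =
           (fun x => atan ((x - cos (t k)) / sin (t k))).
    by apply/funext => x; rewrite -atanN invrN mulNr opprK mulrC.
  rewrite -E; apply: cvgN.
  apply: (cvg_comp (fun x => (- sin (t k))^-1 * (x - cos (t k))) atan) (@cvgy_atan R).
  by apply: gt0_cvgMry; [rewrite invr_gt0 oppr_gt0|exact: cvg_addrr].
- rewrite gtr0_norm//; apply: cvgMl_tmp.
  apply: (cvg_comp (fun x => (x - cos (t k)) / sin (t k)) atan) (@cvgy_atan R).
  by apply: gt0_cvgMly; [rewrite invr_gt0|exact: cvg_addrr].
- rewrite s0 normr0 mul0r.
  have -> : (fun x => 0 * atan ((x - cos (t k)) / 0)) = cst 0.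
    by apply/funext => x; rewrite mul0r.
  exact: cvg_cst.
Unshelve. all: by end_near.
Qed.

End Primitive.

Section PowRNat.
Variable R : realType.

Lemma cvgn_powRy (a : R) : 0 < a -> n%:R `^ a @[n --> \oo] --> +oo.
Proof.
move=> a0; apply/cvgryPge => A; near=> n.
have B0 : 0 <= Num.max A 1 by rewrite le_max ler01 orbT.
apply: (@le_trans _ _ ((Num.max A 1 `^ a^-1) `^ a)).
  by rewrite -powRrM mulVf ?gt_eqF// powRr1// le_max lexx.
rewrite ge0_ler_powR ?nnegrE ?powR_ge0 ?(ltW a0)//.
by near: n; exact: nbhs_infty_ger.
Unshelve. all: by end_near.
Qed.

Lemma cvgn_powRN0 (a : R) : 0 < a -> n%:R `^ (- a) @[n --> \oo] --> 0.
Proof.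
move=> a0; under eq_fun do rewrite powRN.
apply/gtr0_cvgV0; last exact: cvgn_powRy.
by near=> n; rewrite powR_gt0// ltr0n; near: n; exact: nbhs_infty_gt.
Unshelve. all: by end_near.
Qed.

End PowRNat.

(** * Riemann sums of 1/(1 + x^d) *)

Section RiemannSum.
Variables (R : realType) (d : nat).
Hypothesis d_gt1 : (1 < d)%N.

Let d_gt0 : 0 < d%:R :> R.
Proof. by rewrite ltr0n (ltn_trans _ d_gt1). Qed.

Notation F := (@root_primitive R d).
Notation I := (@root_integral R d).

Lemma root_primitive_step (a b : R) : 0 <= a -> a < b ->
  (b - a) / (1 + b ^+ d) <= F b - F a <= (b - a) / (1 + a ^+ d).
Proof.
move=> a0 ab.
have dF (x : R) : 0 <= x -> is_derive x 1 F (1 + x ^+ d)^-1.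
  exact: is_derive_root_primitive.
have [||c] := @MVT R F (fun x => (1 + x ^+ d)^-1) a b ab.
- by move=> x /[!in_itv]/= /andP[ax _]; apply: dF; rewrite (le_trans a0)// ltW.
- apply: derivable_within_continuous => x /[!in_itv]/= /andP[ax _].
  by have := dF x (le_trans a0 ax) => ?; exact: ex_derive.
rewrite in_itv/= => /andP[ac cb] ->; rewrite ![_ / _]mulrC.
have pos (x : R) : 0 <= x -> 0 < 1 + x ^+ d by move=> x0; rewrite ltr_wpDr// exprn_ge0.
have c0 : 0 <= c by apply: le_trans a0 (ltW ac).
have b0 : 0 <= b by apply: le_trans c0 (ltW cb).
by rewrite !ler_pM2r ?subr_gt0// !lef_pV2 ?posrE ?pos// !lerD2l !lerXn2r ?nnegrE// ltW.
Qed.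

Lemma root_primitive_le (a b : R) : 0 <= a -> a <= b -> F a <= F b.
Proof.
move=> a0; rewrite le_eqVlt => /predU1P[->//|ab].
have /andP[Fab _] := root_primitive_step a0 ab.
rewrite -subr_ge0; apply: le_trans Fab; rewrite divr_ge0 ?subr_ge0 ?(ltW ab)//.
by rewrite addr_ge0// exprn_ge0// (le_trans a0)// ltW.
Qed.

Lemma root_primitive_ub (a : R) : 0 <= a -> F a - F 0 <= I.
Proof.
move=> a0; rewrite lerBlDl.
apply: (cvgr_to_ge (root_primitive_cvg d_gt1)).
by near=> x; apply: root_primitive_le => //; near: x; exact: nbhs_pinfty_ge.
Unshelve. all: by end_near.
Qed.

Lemma sum_root_ub (h : R) (N : nat) : 0 < h ->
  \sum_(m < N) h / (1 + (m.+1%:R * h) ^+ d) <= I.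
Proof.
move=> h0; apply: le_trans (@root_primitive_ub (N%:R * h) _); last first.
  by rewrite mulr_ge0// ltW.
elim: N => [|N IH]; first by rewrite big_ord0 mul0r subrr.
rewrite big_ord_recr/=.
have := @root_primitive_step (N%:R * h) (N.+1%:R * h).
rewrite ltr_pM2r// ltr_nat ltnSn => /(_ (mulr_ge0 (ler0n _ _) (ltW h0)) isT) /andP[+ _].
by rewrite -mulrBl -natrB// subSnn mul1r; move: IH; lra.
Qed.

Lemma sum_root_lb (h : R) (N : nat) : 0 < h ->
  F (N.+1%:R * h) - F h <= \sum_(m < N) h / (1 + (m.+1%:R * h) ^+ d).
Proof.
move=> h0.
elim: N => [|N IH]; first by rewrite big_ord0 mul1r subrr.
rewrite big_ord_recr/=.
have := @root_primitive_step (N.+1%:R * h) (N.+2%:R * h).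
rewrite ltr_pM2r// ltr_nat ltnSn => /(_ (mulr_ge0 (ler0n _ _) (ltW h0)) isT) /andP[_].
by rewrite -mulrBl -natrB// subSnn mul1r; move: IH; lra.
Qed.

(** With h = y^(-1/d), this is y^(1/d) times a term of the right-endpoint Riemann sum of 1/(1 + x^d)
    with mesh h. *)
Lemma root_fraction (y : R) (m : nat) : 0 < y ->
  y / (m.+1%:R ^+ d + y) = (y `^ d%:R^-1) * (y `^ (- d%:R^-1) / (1 + (m.+1%:R * y `^ (- d%:R^-1)) ^+ d)).
Proof.
move=> y0; rewrite mulrA powRN divff ?gt_eqF ?powR_gt0// mul1r exprMn exprVn.
have -> : y `^ d%:R^-1 ^+ d = y.
  by rewrite -powR_mulrn ?powR_ge0// -powRrM mulVf ?gt_eqF// powRr1 ?ltW.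
have m0 : 0 < m.+1%:R ^+ d :> R by rewrite exprn_gt0.
by field; rewrite !gt_eqF//= addr_gt0.
Qed.

Lemma sum_root_fraction_ub (y : R) (N : nat) : 0 < y ->
  \sum_(m < N) y / (m.+1%:R ^+ d + y) <= y `^ d%:R^-1 * I.
Proof.
move=> y0; under eq_bigr do rewrite root_fraction//.
by rewrite -mulr_sumr ler_pM2l ?powR_gt0// sum_root_ub// powR_gt0.
Qed.

Lemma root_integral_gt0 : 0 < I.
Proof.
rewrite divr_gt0 ?pi_gt0// mulr_gt0//.
by have := @sin_piM_gt0 R d d_gt1 1; rewrite mul1r; apply.
Qed.

Let alpha : R := (d%:R - 1) / d%:R.

Lemma powRn_fraction (c : R) (n : nat) : 0 <= c ->
  (c * n%:R ^+ d.-1) `^ d%:R^-1 = c `^ d%:R^-1 * n%:R `^ alpha.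
Proof.
move=> c0; rewrite powRM ?exprn_ge0//; congr (_ * _).
rewrite -(@powR_mulrn R n%:R)// -powRrM.
by rewrite /alpha -subn1 natrB// ltnW.
Qed.

Lemma alpha_gt0 : 0 < alpha.
Proof. by rewrite divr_gt0// subr_gt0 ltr1n. Qed.

Lemma root_primitive_continuous0 : {for 0, continuous F}.
Proof.
have dF0 := is_derive_root_primitive d_gt1 (lexx (0 : R)).
by apply: differentiable_continuous; apply/derivable1_diffP.
Qed.

Lemma root_primitive_increment_cvg (h : nat -> R) :
  h n @[n --> \oo] --> 0 -> n.+1%:R * h n @[n --> \oo] --> +oo ->
  F (n.+1%:R * h n) - F (h n) @[n --> \oo] --> I.
Proof.
move=> h0 hy.
have -> : I = F 0 + I - F 0 by rewrite addrAC subrr add0r.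
apply: cvgB; first exact: cvg_comp hy (root_primitive_cvg d_gt1).
exact: cvg_comp h0 root_primitive_continuous0.
Qed.

Lemma root_scale_cvg (c : R) : 0 < c ->
  (c * n%:R ^+ d.-1) `^ (- d%:R^-1) @[n --> \oo] --> 0.
Proof.
move=> c0.
have : (c `^ d%:R^-1)^-1 * n%:R `^ (- alpha) @[n --> \oo] --> (c `^ d%:R^-1)^-1 * 0.
  by apply: cvgMl_tmp; exact: cvgn_powRN0 alpha_gt0.
rewrite mulr0; under eq_cvg do rewrite powRN -invfM -powRn_fraction ?(ltW c0)// -powRN.
exact.
Qed.

(** The mesh is of order n^(-alpha) with alpha < 1, so n steps exhaust the half-line in the
    limit. *)
Lemma root_scale_cvgy (c : R) : 0 < c ->
  n.+1%:R * (c * n%:R ^+ d.-1) `^ (- d%:R^-1) @[n --> \oo] --> +oo.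
Proof.
move=> c0.
have : (c `^ d%:R^-1)^-1 * n%:R `^ (1 - alpha) @[n --> \oo] --> +oo.
  have a1 : 0 < 1 - alpha by rewrite subr_gt0 ltr_pdivrMr// mul1r ltrBlDr ltrDl.
  have cp : 0 < c `^ d%:R^-1 by rewrite powR_gt0.
  apply/cvgryPge => A; near=> n.
  rewrite mulrC ler_pdivlMr//; near: n.
  exact: (cvgry_ge (cvgn_powRy a1)).
apply: ger_cvgy; near=> n.
have n0 : 0 < n%:R :> R by rewrite ltr0n; near: n; exact: nbhs_infty_gt.
rewrite powRN powRn_fraction ?(ltW c0)// invfM -powRN mulrCA.
rewrite ler_pM2l ?invr_gt0 ?powR_gt0//.
rewrite powRD ?(gt_eqF n0) ?implybT// powRr1 ?(ltW n0)//.
by rewrite powRN ler_pM2r ?invr_gt0 ?powR_gt0// ler_nat.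
Unshelve. all: by end_near.
Qed.

Lemma sum_root_fraction_bounds (c : R) (n : nat) : 0 < c -> (0 < n)%N ->
  c `^ d%:R^-1 * (F (n.+1%:R * (c * n%:R ^+ d.-1) `^ (- d%:R^-1)) -
    F ((c * n%:R ^+ d.-1) `^ (- d%:R^-1))) <=
  n%:R `^ (- alpha) * (\sum_(m < n) (c * n%:R ^+ d.-1) / (m.+1%:R ^+ d + c * n%:R ^+ d.-1))
  <= c `^ d%:R^-1 * I.
Proof.
move=> c0 n0; have np : 0 < n%:R :> R by rewrite ltr0n.
have y0 : 0 < c * n%:R ^+ d.-1 by rewrite mulr_gt0// exprn_gt0.
under eq_bigr do rewrite root_fraction//.
rewrite -mulr_sumr mulrA powRn_fraction ?(ltW c0)//.
rewrite [n%:R `^ (- alpha)]powRN mulrCA mulVf ?gt_eqF ?powR_gt0// mulr1.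
by rewrite !ler_pM2l ?powR_gt0// sum_root_lb ?powR_gt0// sum_root_ub ?powR_gt0.
Qed.

Lemma cvg_sum_root_fraction (c : R) : 0 < c ->
  n%:R `^ (- alpha) * (\sum_(m < n) (c * n%:R ^+ d.-1) / (m.+1%:R ^+ d + c * n%:R ^+ d.-1))
    @[n --> \oo] --> c `^ d%:R^-1 * I.
Proof.
move=> c0.
have lb := cvgMl_tmp (a := c `^ d%:R^-1)
  (root_primitive_increment_cvg (root_scale_cvg c0) (root_scale_cvgy c0)).
apply: (squeeze_cvgr _ (lb _) (cvg_cst _)); near=> n.
by apply: sum_root_fraction_bounds => //; near: n; exact: nbhs_infty_gt.
Unshelve. all: by end_near.
Qed.

End RiemannSum.

(** * The urn chain *)

Section PowerBounds.
Variable R : realType.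
Implicit Types (x y z : R) (n : nat).

Lemma bernoulli_ge x n : -1 <= x -> 1 + n%:R * x <= (1 + x) ^+ n.
Proof.
move=> x1; elim: n => [|n IH]; first by rewrite mul0r addr0.
have x0 : 0 <= 1 + x by lra.
rewrite exprS; apply: le_trans (ler_wpM2l x0 IH).
rewrite -natr1 -subr_ge0.
rewrite (_ : _ - _ = n%:R * x ^+ 2); last by ring.
by rewrite mulr_ge0 ?sqr_ge0.
Qed.

Lemma expr1D_le x n : 0 <= x <= 1 -> (1 + x) ^+ n <= 1 + n%:R * x + 3 ^+ n * x ^+ 2.
Proof.
move=> /andP[x0 x1]; elim: n => [|n IH].
  by rewrite !expr0 mul0r addr0 mul1r lerDl sqr_ge0.
have x1p : 0 <= 1 + x by lra.
rewrite exprS; apply: le_trans (ler_wpM2l x1p IH) _.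
have n3 : n%:R <= 3 ^+ n :> R.
  by elim: n {IH} => [|n IH]; rewrite ?ler01// exprS -natr1; have := @exprn_ege1 R n 3; rewrite ler1n => /(_ isT); lra.
rewrite -subr_ge0 exprS -natr1.
rewrite (_ : _ - _ = x ^+ 2 * (3 ^+ n * (2 - x) - n%:R)); last by ring.
rewrite mulr_ge0 ?sqr_ge0// subr_ge0 (le_trans n3)//.
by rewrite ler_peMr ?exprn_ge0//; lra.
Qed.

Lemma inv1D_le z : 0 <= z -> (1 + z)^-1 <= 1 - z + z ^+ 2.
Proof.
move=> z0; have z1 : 0 < 1 + z by lra.
rewrite -[leLHS]mul1r ler_pdivrMr//.
rewrite (_ : _ * _ = 1 + z ^+ 3); last by ring.
by rewrite lerDl exprn_ge0.
Qed.

Lemma exprV1D_le z n : 0 <= z -> (1 + z) ^- n <= 1 - n%:R * z + (n%:R * z) ^+ 2.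
Proof.
move=> z0; have z1 : 0 < 1 + z by lra.
apply: le_trans (inv1D_le (mulr_ge0 (ler0n _ n) z0)).
rewrite lef_pV2 ?posrE ?exprn_gt0//; last by rewrite ltr_wpDr// mulr_ge0.
by apply: bernoulli_ge; lra.
Qed.

Lemma exprV1D_expR z n : 0 <= z -> expR (- (n%:R * z)) <= (1 + z) ^- n.
Proof.
move=> z0; have z1 : 0 < 1 + z by lra.
rewrite expRN lef_pV2 ?posrE ?exprn_gt0 ?expR_gt0//.
by rewrite expRM_natl lerXn2r ?nnegrE ?expR_ge0 ?(ltW z1)// expR_ge1Dx.
Qed.

Lemma exprV1D_ge z n : 0 <= z -> 1 - n%:R * z <= (1 + z) ^- n.
Proof. by move=> z0; apply: le_trans (exprV1D_expR n z0); exact: expR_ge1Dx. Qed.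

Lemma expr1B_le x n : 0 <= x <= 1 -> (1 - x) ^+ n <= 1 - n%:R * x + (n%:R * x) ^+ 2.
Proof.
move=> /andP[x0 x1]; apply: le_trans (exprV1D_le n x0).
have z1 : 0 < 1 + x by lra.
rewrite -exprVn lerXn2r ?nnegrE ?subr_ge0 ?invr_ge0 ?(ltW z1)//.
rewrite -[leRHS]mul1r ler_pdivlMr//.
by rewrite (_ : _ * _ = 1 - x ^+ 2) ?gerBl ?sqr_ge0//; ring.
Qed.

(** 1 - x^n is 1 - x times a sum of n powers of x, each at least x^n. This later pays for one factor
    [a] in the error of a chain step. *)
Lemma expr_mul1B_le1 x n : 0 <= x <= 1 -> n%:R * (x ^+ n * (1 - x)) <= 1.
Proof.
move=> /andP[x0 x1]; apply: (@le_trans _ _ (1 - x ^+ n)); last by rewrite gerBl exprn_ge0.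
elim: n => [|n IH]; first by rewrite mul0r expr0 subrr.
rewrite -natr1 mulrDl mul1r exprS.
have xn : 0 <= x ^+ n by rewrite exprn_ge0.
have : n%:R * (x * x ^+ n * (1 - x)) <= n%:R * (x ^+ n * (1 - x)).
  by rewrite ler_wpM2l// ler_wpM2r ?subr_ge0// ler_piMl.
have : x * x ^+ n * (1 - x) <= x ^+ n * (1 - x).
  by rewrite ler_wpM2r ?subr_ge0// ler_piMl.
by move: IH; lra.
Qed.

Lemma expR_sub_le x : 0 <= x -> 0 <= expR x - 1 - x <= x ^+ 2 * expR x.
Proof.
move=> x0; have e1 := expR_ge1Dx x; have e2 := expR_ge1Dx (- x).
have e3 : expR x * expR (- x) = 1 by rewrite -expRD subrr expR0.
have e4 : expR x - 1 <= x * expR x.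
  have := ler_wpM2l (expR_ge0 x) e2; rewrite e3; lra.
have e5 := ler_wpM2l x0 e4.
apply/andP; split; first by lra.
by move: e5; rewrite expr2; lra.
Qed.

Lemma mul_expRN_le1 x : 0 <= x -> x * expR (- x) <= 1.
Proof.
move=> x0; rewrite expRN ler_pdivrMr ?expR_gt0// mul1r.
by have := expR_ge1Dx x; lra.
Qed.

Lemma exprB_le x y n : 0 <= y <= x -> x <= 1 -> x ^+ n - y ^+ n <= n%:R * (x - y).
Proof.
move=> /andP[y0 yx] x1; elim: n => [|n IH]; first by rewrite subrr mul0r.
rewrite !exprS -natr1.
have yn : 0 <= y ^+ n <= 1.
  by rewrite exprn_ge0//= exprn_ile1// (le_trans yx).
have : x * (x ^+ n - y ^+ n) <= x ^+ n - y ^+ n.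
  by rewrite ler_piMl// subr_ge0 lerXn2r ?nnegrE// (le_trans y0).
have : (x - y) * y ^+ n <= x - y.
  by rewrite ler_piMr ?subr_ge0//; case/andP: yn.
by move: IH; lra.
Qed.

End PowerBounds.

(** * The Markov chain of ancestor counts *)

Section Chain.
Variables (R : realType) (d : nat).

(** The chance that none of the d arrows of vertex k+1 meets a given set of [a] among the k earlier
    vertices. *)
Definition miss_prob (k a : nat) : R := (1 - a%:R / k%:R) ^+ d.

(** The backward operator: the expectation of f(A_(k+1)) given A_k = a. *)
Definition chain_step (k : nat) (f : nat -> R) (a : nat) : R :=
  miss_prob k a * f a + (1 - miss_prob k a) * f a.+1.

(** The expectation of f(A_(k+j)) given A_k = a, unrolled from the first step. *)
Fixpoint chain_iter (k j : nat) (f : nat -> R) : nat -> R :=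
  if j is j'.+1 then chain_step k (chain_iter k.+1 j' f) else f.

Implicit Types (f g : nat -> R) (a k j : nat).

Lemma ratio_bounds k a : (0 < k)%N -> (a <= k)%N -> 0 <= (a%:R / k%:R : R) <= 1.
Proof.
move=> k0 ak; rewrite divr_ge0//= ler_pdivrMr ?ltr0n// mul1r ler_nat//.
Qed.

Lemma miss_prob_bounds k a : (0 < k)%N -> (a <= k)%N -> 0 <= miss_prob k a <= 1.
Proof.
move=> k0 ak; have /andP[r0 r1] := ratio_bounds k0 ak.
by rewrite exprn_ge0 ?subr_ge0//= exprn_ile1 ?subr_ge0// gerBl.
Qed.

Lemma chain_step_le k f g a : (0 < k)%N -> (a <= k)%N ->
  f a <= g a -> f a.+1 <= g a.+1 -> chain_step k f a <= chain_step k g a.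
Proof.
move=> k0 ak fg fg1; have /andP[m0 m1] := miss_prob_bounds k0 ak.
by rewrite lerD// ler_wpM2l// subr_ge0.
Qed.

(** Only the states reachable from [a] have to be compared; a <= k keeps the transition
    probabilities in [0, 1]. *)
Lemma chain_iter_le k j f g a : (0 < k)%N -> (a <= k)%N ->
  (forall b, (a <= b <= k + j)%N -> f b <= g b) ->
  chain_iter k j f a <= chain_iter k j g a.
Proof.
elim: j k a => [|j IH] k a k0 ak fg /=.
  by apply: fg; rewrite leqnn addn0.
apply: chain_step_le => //; apply: IH => //; first exact: leqW.
  by move=> b /andP[ab bk]; apply: fg; rewrite ab -addSnnS.
by move=> b /andP[ab bk]; apply: fg; rewrite ltnW//= -addSnnS.
Qed.

Lemma chain_iter_lin k j (c : R) f g a :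
  chain_iter k j (fun b => c * f b + g b) a = c * chain_iter k j f a + chain_iter k j g a.
Proof.
elim: j k a => [//|j IH] k a /=.
by rewrite /chain_step !IH; ring.
Qed.

Lemma eq_chain_iter k j f g a : f =1 g -> chain_iter k j f a = chain_iter k j g a.
Proof. by move=> /funext ->. Qed.

Lemma chain_iter_cst k j (c : R) a : chain_iter k j (fun=> c) a = c.
Proof.
elim: j k a => [//|j IH] k a /=.
by rewrite /chain_step !IH; ring.
Qed.

Lemma chain_iter_sub k j f g a :
  chain_iter k j (fun b => f b - g b) a = chain_iter k j f a - chain_iter k j g a.
Proof.
rewrite -[LHS]/(chain_iter k j (fun b => f b - g b) a).
rewrite (@eq_chain_iter k j _ (fun b => -1 * g b + f b)); last by move=> b; ring.
by rewrite chain_iter_lin; ring.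
Qed.

Lemma chain_iterZ k j c f a :
  chain_iter k j (fun b => c * f b) a = c * chain_iter k j f a.
Proof.
rewrite (@eq_chain_iter k j _ (fun b => c * f b + 0)); last by move=> b; rewrite addr0.
by rewrite (chain_iter_lin k j c f (fun=> 0)) chain_iter_cst addr0.
Qed.

Lemma chain_iter_norm k j f g a : (0 < k)%N -> (a <= k)%N ->
  (forall b, (a <= b <= k + j)%N -> `|f b| <= g b) ->
  `|chain_iter k j f a| <= chain_iter k j g a.
Proof.
move=> k0 ak fg; rewrite ler_norml; apply/andP; split.
  rewrite -[leLHS]mulN1r -chain_iterZ; apply: chain_iter_le => // b /fg.
  by rewrite ler_norml mulN1r => /andP[].
by apply: chain_iter_le => // b /fg; rewrite ler_norml => /andP[].
Qed.

Lemma chain_iterD k i j f a :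
  chain_iter k (i + j) f a = chain_iter k i (chain_iter (k + i) j f) a.
Proof.
elim: i k a => [|i IH] k a; first by rewrite addn0.
by rewrite addSn/= /chain_step !IH addSnnS.
Qed.

(** By Bernoulli the jump probability is at most d a / k. It is relaxed to a ((1 + 1/k)^d - 1)
    because the factors ((k + 1) / k)^d telescope over the steps. *)
Lemma chain_step_mean k a : (0 < k)%N -> (a <= k)%N ->
  chain_step k (fun b => b%:R) a <= a%:R * (1 + k%:R^-1) ^+ d.
Proof.
move=> k0 ak; have /andP[r0 r1] := ratio_bounds k0 ak.
rewrite /chain_step -natr1.
rewrite (_ : _ + _ = a%:R + (1 - miss_prob k a)); last by ring.
have kp : 0 < k%:R :> R by rewrite ltr0n.
have := @bernoulli_ge R (- (a%:R / k%:R)) d; rewrite lerN2 => /(_ r1) b1.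
have := @bernoulli_ge R (k%:R^-1) d.
have V0 : 0 <= k%:R^-1 :> R by rewrite invr_ge0 ltW.
move=> /(_ (le_trans _ V0)); rewrite lerN10 => /(_ isT) b2.
apply: le_trans (ler_wpM2l (ler0n _ a) b2).
rewrite mulrDr mulr1 lerD2l; rewrite /miss_prob mulrCA -/(_ / _).
by move: b1; lra.
Qed.

Lemma chain_iter_mean k j a : (0 < k)%N -> (a <= k)%N ->
  chain_iter k j (fun b => b%:R) a <= a%:R * ((k + j)%:R / k%:R) ^+ d.
Proof.
elim: j k a => [|j IH] k a k0 ak /=.
  by rewrite addn0 divff ?expr1n ?mulr1// pnatr_eq0 -lt0n.
set c : R := ((k.+1 + j)%:R / k.+1%:R) ^+ d.
apply: (@le_trans _ _ (chain_step k (fun b => c * b%:R) a)).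
  apply: chain_step_le => //.
    by rewrite mulrC; apply: IH => //; exact: leqW.
  by rewrite mulrC; exact: IH.
have -> : chain_step k (fun b => c * b%:R) a = c * chain_step k (fun b => b%:R) a.
  by rewrite /chain_step; ring.
have c0 : 0 <= c by rewrite exprn_ge0// divr_ge0.
apply: le_trans (ler_wpM2l c0 (chain_step_mean k0 ak)) _.
rewrite mulrCA -exprMn ler_wpM2l// -addSnnS.
rewrite (_ : (k.+1 + j)%:R / k.+1%:R * (1 + k%:R^-1) = (k.+1 + j)%:R / k%:R)//.
have kp : k%:R != 0 :> R by rewrite pnatr_eq0 -lt0n.
have kp1 : k%:R + 1 != 0 :> R by rewrite natr1 pnatr_eq0.
by rewrite -[k.+1%:R]natr1; field; rewrite kp kp1.
Qed.

End Chain.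

(** * Early times: the Yule approximation *)

Section HitWeight.
Variables (R : realType) (d : nat).
Hypothesis d_gt1 : (1 < d)%N.

(* Here s = s_(k+1) and P = (1 + 1/k)^d - 1, for which s_k is exactly
   s / (1 + (1 - s) P). *)
Lemma geometric_step_bound (s P p D : R) (a : nat) :
  0 <= s <= 1 -> 0 <= P -> `|a%:R * P - p| <= D ->
  `|s ^+ a * (1 - p * (1 - s)) - (s / (1 + (1 - s) * P)) ^+ a|
    <= s ^+ a * (1 - s) * (D + (a%:R * P) ^+ 2).
Proof.
move=> /andP[s0 s1] P0 DP.
have s1' : 0 <= 1 - s by rewrite subr_ge0.
set e := (1 - s) * P; have e0 : 0 <= e by rewrite mulr_ge0.
rewrite exprMn exprVn -mulrBr normrM (ger0_norm (exprn_ge0 _ s0)) -mulrA.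
rewrite ler_wpM2l ?exprn_ge0//.
have l := exprV1D_ge a e0; have u := exprV1D_le a e0.
have D1 : (1 - s) * `|a%:R * P - p| <= (1 - s) * D by rewrite ler_wpM2l.
have -> : 1 - p * (1 - s) - (1 + e) ^- a =
  (1 - s) * (a%:R * P - p) - ((1 + e) ^- a - (1 - a%:R * e)) by rewrite /e; ring.
apply: le_trans (ler_normB _ _) _.
rewrite normrM (ger0_norm s1') mulrDr lerD// ger0_norm ?subr_ge0//.
rewrite lerBlDl; apply: le_trans u _; rewrite lerD2l.
rewrite (_ : a%:R * e = (1 - s) * (a%:R * P)); last by rewrite /e; ring.
rewrite exprMn ler_wpM2r ?sqr_ge0// expr2 ler_piMr// lerBlDr lerDl//.
Qed.

(** In units of (a/k)^2, 3^d + d^2 bounds the deviation of the jump probability from its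
    linearization, and the last summand bounds the square of that linearization. *)
Definition hit_weight_const : R := 3 ^+ d + d%:R ^+ 2 + (2 * 3 ^+ d) ^+ 2.

Lemma hit_weight_const_ge0 : 0 <= hit_weight_const.
Proof. by rewrite !addr_ge0 ?exprn_ge0// ?mulr_ge0// exprn_ge0. Qed.

Lemma jump_prob_bounds (k a : nat) : (0 < k)%N -> (a <= k)%N ->
  let P : R := (1 + k%:R^-1) ^+ d - 1 in
  [/\ 0 <= P, a%:R * P <= 2 * 3 ^+ d * (a%:R / k%:R) &
      `|a%:R * P - (1 - miss_prob R d k a)| <=
      (3 ^+ d + d%:R ^+ 2) * (a%:R / k%:R) ^+ 2].
Proof.
move=> k0 ak P; have /andP[r0 r1] := @ratio_bounds R k a k0 ak.
have kp : 0 < k%:R :> R by rewrite ltr0n.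
have V0 : 0 <= k%:R^-1 :> R by rewrite invr_ge0 ltW.
have V1 : k%:R^-1 <= 1 :> R by rewrite invf_le1// ler1n.
have Pl : d%:R * k%:R^-1 <= P.
  by rewrite /P lerBrDl bernoulli_ge// (le_trans _ V0)// lerN10.
have Pu : P <= d%:R * k%:R^-1 + 3 ^+ d * k%:R^-1 ^+ 2.
  by rewrite /P lerBlDl addrA expr1D_le// V0.
have d3 : d%:R <= 3 ^+ d :> R.
  elim: (d) => [|n IH]; first exact: exprn_ge0.
  by rewrite exprS -natr1; have := @exprn_ege1 R n 3; rewrite ler1n => /(_ isT); lra.
have P0 : 0 <= P by apply: le_trans Pl; rewrite mulr_ge0.
have := @bernoulli_ge R (- (a%:R / k%:R)) d; rewrite lerN2 => /(_ r1) ml.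
have := @expr1B_le R (a%:R / k%:R) d; rewrite r0 r1 => /(_ isT) mu.
rewrite -/(miss_prob R d k a) in ml mu.
have a0 : 0 <= a%:R :> R by [].
have Pla := ler_wpM2l a0 Pl; have Pua := ler_wpM2l a0 Pu.
(* Since a <= a^2 for natural numbers, the second-order part of a P is also O((a/k)^2). *)
have aa : a%:R / k%:R ^+ 2 <= (a%:R / k%:R) ^+ 2 :> R.
  rewrite expr_div_n ler_wpM2r ?invr_ge0 ?exprn_ge0//.
  by rewrite -natrX ler_nat; case: (a) => // b; rewrite leq_pmulr.
split => //.
- apply: le_trans (ler_wpM2l a0 Pu) _.
  rewrite mulrDr (_ : _ + _ = (d%:R + 3 ^+ d * k%:R^-1) * (a%:R / k%:R)); last by ring.
  rewrite ler_wpM2r//.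
  have : 3 ^+ d * k%:R^-1 <= 3 ^+ d :> R by rewrite ler_piMr// exprn_ge0.
  by move: d3; lra.
rewrite ler_norml; apply/andP; split.
  apply: (@le_trans _ _ 0); first by rewrite oppr_le0 mulr_ge0 ?addr_ge0 ?exprn_ge0.
  by move: Pla ml; lra.
have : 3 ^+ d * (a%:R / k%:R ^+ 2) <= 3 ^+ d * (a%:R / k%:R) ^+ 2 :> R.
  by rewrite ler_wpM2l ?exprn_ge0.
rewrite -exprVn.
by move: Pua mu; rewrite mulrDl exprMn mulrDr; lra.
Qed.

(* (hit_weight c k)^a is the Laplace transform at [a] of the linearized (Yule)
   chain; c k^-d = hit_weight^-1 - 1 is the explicit solution of its dual ODE. *)
Definition hit_weight (c : R) (k : nat) : R := k%:R ^+ d / (k%:R ^+ d + c).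

Lemma hit_weight_bounds c k : 0 <= c -> (0 < k)%N -> 0 <= hit_weight c k <= 1.
Proof.
move=> c0 k0; have kp : 0 < k%:R ^+ d :> R by rewrite exprn_gt0 ?ltr0n.
have s0 : 0 < k%:R ^+ d + c by rewrite ltr_wpDr.
by rewrite divr_ge0 ?(ltW kp) ?(ltW s0)//= ler_pdivrMr// mul1r lerDl.
Qed.

(** The error is s^a (1 - s) times O((a/k)^2). As a s^a (1 - s) <= 1, one factor [a] disappears.
    What remains is linear in [a], so the first moment of the chain suffices to average it, and it
    does not involve c. *)
Lemma hit_weight_step_error c k a : 0 <= c -> (0 < k)%N -> (a <= k)%N ->
  `|chain_step d k (fun b => hit_weight c k.+1 ^+ b) a - hit_weight c k ^+ a|
  <= hit_weight_const * a%:R / k%:R ^+ 2.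
Proof.
move=> c0 k0 ak; have /andP[r0 r1] := @ratio_bounds R k a k0 ak.
have [P0 Pu PB] := jump_prob_bounds k0 ak.
set P := _ - 1 in P0 Pu PB.
set s := hit_weight c k.+1.
have sb : 0 <= s <= 1 by apply: hit_weight_bounds.
have kp : 0 < k%:R :> R by rewrite ltr0n.
have sE : hit_weight c k = s / (1 + (1 - s) * P).
  rewrite /s /hit_weight.
  have -> : k.+1%:R ^+ d = k%:R ^+ d * (1 + P).
    rewrite /P addrC subrK -exprMn; congr (_ ^+ _).
    by rewrite -natr1 mulrDr mulr1 divff// gt_eqF.
  have Kp : 0 < k%:R ^+ d :> R by rewrite exprn_gt0.
  have h1 : 0 < k%:R ^+ d + c by rewrite ltr_wpDr.
  have h2 : 0 < k%:R ^+ d * (1 + P) + c by rewrite ltr_wpDr// mulr_gt0// ltr_wpDr.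
  have h3 : 0 < k%:R ^+ d * (1 + P) + c + c * P by rewrite ltr_wpDr// mulr_ge0.
  field; rewrite !gt_eqF//=.
  by move: h3; congr (0 < _); ring.
rewrite sE.
have -> : chain_step d k (fun b => s ^+ b) a = s ^+ a * (1 - (1 - miss_prob R d k a) * (1 - s)).
  by rewrite /chain_step exprS; ring.
apply: le_trans (geometric_step_bound sb P0 PB) _.
have /andP[s0 s1] := sb.
set r := a%:R / k%:R in r0 r1 Pu PB *.
have aP0 : 0 <= a%:R * P by rewrite mulr_ge0.
have r2 : (a%:R * P) ^+ 2 <= (2 * 3 ^+ d) ^+ 2 * r ^+ 2.
  by rewrite -exprMn lerXn2r ?nnegrE// mulr_ge0// mulr_ge0// exprn_ge0.
apply: (@le_trans _ _ (s ^+ a * (1 - s) * (hit_weight_const * r ^+ 2))).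
  by rewrite ler_wpM2l ?mulr_ge0 ?exprn_ge0 ?subr_ge0// /hit_weight_const [leRHS]mulrDl lerD2l.
rewrite (_ : _ * _ = a%:R * (s ^+ a * (1 - s)) * (hit_weight_const * a%:R / k%:R ^+ 2)); last first.
  by rewrite (expr_div_n a%:R k%:R 2); ring.
apply: ler_piMl; last exact: expr_mul1B_le1.
by rewrite divr_ge0 ?exprn_ge0// mulr_ge0// hit_weight_const_ge0.
Qed.

(** After the first step, the errors of the remaining ones are averaged over the new state. Its mean
    grows by (1 + 1/k)^d, which turns (k + 1)^-d into k^-d exactly, so the bound keeps its form. *)
Lemma hit_weight_iter_error c k j a : 0 <= c -> (0 < k)%N -> (a <= k)%N ->
  `|chain_iter d k j (fun b => hit_weight c (k + j) ^+ b) a - hit_weight c k ^+ a|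
  <= hit_weight_const * a%:R * (j%:R * (k + j)%:R ^+ (d - 2) / k%:R ^+ d).
Proof.
move=> c0; elim: j k a => [|j IH] k a k0 ak.
  by rewrite addn0 subrr normr0 !mul0r mulr0.
have K0 := hit_weight_const_ge0.
have kp : 0 < k%:R :> R by rewrite ltr0n.
rewrite /= -addSnnS.
set f := chain_iter _ _ _ _; set g := fun b => hit_weight c k.+1 ^+ b.
pose D := hit_weight_const * (j%:R * (k.+1 + j)%:R ^+ (d - 2) / k.+1%:R ^+ d).
have D0 : 0 <= D by rewrite mulr_ge0// divr_ge0 ?mulr_ge0 ?exprn_ge0.
have fg : `|chain_step d k f a - chain_step d k g a| <= D * chain_step d k (fun b => b%:R) a.
  have -> : chain_step d k f a - chain_step d k g a = chain_iter d k 1 (fun b => f b - g b) a.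
    by rewrite /= /chain_step; ring.
  rewrite -[chain_step _ _ _ _]/(chain_iter d k 1 (fun b => b%:R) a) -chain_iterZ.
  apply: chain_iter_norm => // b /andP[ab bk].
  apply: le_trans (IH k.+1 b isT _) _; first by rewrite -addn1.
  by rewrite /D le_eqVlt; apply/orP; left; apply/eqP; ring.
have st := hit_weight_step_error c0 k0 ak.
rewrite (_ : _ - _ = (chain_step d k f a - chain_step d k g a) +
   (chain_step d k g a - hit_weight c k ^+ a)); last by ring.
apply: le_trans (ler_normD _ _) _.
apply: le_trans (lerD fg st) _.
apply: le_trans (lerD (ler_wpM2l D0 (@chain_step_mean R d k a k0 ak)) (lexx _)) _.
have -> : D * (a%:R * (1 + k%:R^-1) ^+ d) =
   hit_weight_const * a%:R * (j%:R * (k.+1 + j)%:R ^+ (d - 2) / k%:R ^+ d).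
  have -> : 1 + k%:R^-1 = k.+1%:R / k%:R :> R.
    by rewrite -natr1 mulrDl divff ?mul1r// gt_eqF.
  rewrite /D expr_div_n; field.
  by rewrite !expf_neq0// ?gt_eqF ?ltr0n.
rewrite -mulrDr ler_wpM2l ?mulr_ge0//.
rewrite -[j.+1%:R]natr1 [(j%:R + 1) * _]mulrDl mul1r mulrDl lerD2l.
have -> : k%:R ^+ d = k%:R ^+ (d - 2) * k%:R ^+ 2 :> R by rewrite -exprD subnK.
rewrite [(_ * k%:R ^+ 2)^-1]invfM mulrA ler_peMl ?invr_ge0 ?exprn_ge0//.
rewrite -expr_div_n exprn_ege1//.
rewrite ler_pdivlMr// mul1r ler_nat.
by rewrite addSn ltnW// ltnS leq_addr.
Qed.

End HitWeight.

(** * Late times: the deterministic flow *)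

Section Flow.
Variables (R : realType) (e : nat).
Hypothesis e_gt0 : (0 < e)%N.
Let d := e.+1.

(* With x = k - a and y = k, the quantity x^-e - y^-e is a first integral of the
   deterministic flow (A/k)' = (1 - (1 - A/k)^d - A/k)/k. *)
Definition flow (gamma x y : R) : R := expR (- (gamma * (x ^- e - y ^- e))).

Lemma flow_le1 gamma x y : 0 <= gamma -> 0 < x -> x <= y -> flow gamma x y <= 1.
Proof.
move=> g0 x0 xy; rewrite /flow expR_le1 oppr_le0 mulr_ge0// subr_ge0.
have y0 : 0 < y by apply: lt_le_trans xy.
by rewrite lef_pV2 ?posrE ?exprn_gt0// lerXn2r ?nnegrE// ltW.
Qed.

(** The loss of x^-e when x grows by 1, close to e / x^d for large x. *)
Definition decr (x : R) : R := x ^- e - (x + 1) ^- e.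

Lemma decr_bounds (x : R) : 0 < x ->
  e%:R - e%:R ^+ 2 / x <= x ^+ d * decr x <= e%:R.
Proof.
move=> x0; have V0 : 0 <= x^-1 by rewrite invr_ge0 ltW.
have x1 : 0 < x + 1 by rewrite addr_gt0.
have -> : x ^+ d * decr x = x * (1 - (1 + x^-1) ^- e).
  have -> : 1 + x^-1 = (x + 1) / x by rewrite mulrDl divff ?gt_eqF// mul1r.
  rewrite /decr /d exprS expr_div_n; field.
  by rewrite !expf_neq0 ?gt_eqF.
have l := exprV1D_ge e V0; have u := exprV1D_le e V0.
have E : e%:R = x * (e%:R * x^-1) by field; rewrite gt_eqF.
apply/andP; split; last by rewrite [leRHS]E ler_pM2l//; lra.
rewrite (_ : _ - _ = x * (e%:R / x - (e%:R / x) ^+ 2)); last by field; rewrite gt_eqF.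
by rewrite ler_pM2l//; lra.
Qed.

(** A miss, of probability (x/y)^d, raises x by 1, while y always grows by 1. The first-order change
    (x/y)^d gamma [decr x] - gamma [decr y] nearly vanishes, since x^d [decr x] and y^d [decr y] are
    both close to e. The rest is quadratic in [M]. *)
Lemma flow_step (gamma x y M D : R) : 0 <= gamma -> 0 < x -> x <= y ->
  gamma * decr x <= M -> gamma * decr y <= M ->
  gamma * e%:R ^+ 2 / (y ^+ d * x) <= D ->
  `| (x / y) ^+ d * flow gamma (x + 1) (y + 1) + (1 - (x / y) ^+ d) * flow gamma x (y + 1)
    - flow gamma x y | <= D + 2 * (M ^+ 2 * expR M).
Proof.
move=> g0 x0 xy; set X := gamma * decr y; set Y := gamma * decr x => YM XM DD.
have y0 : 0 < y by apply: lt_le_trans xy.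
have decr0 z : 0 < z -> 0 <= decr z.
  move=> z0; rewrite subr_ge0 lef_pV2 ?posrE ?exprn_gt0 ?addr_gt0//.
  by rewrite lerXn2r ?nnegrE ?addr_ge0 ?(ltW z0)// lerDl.
have X0 : 0 <= X by rewrite mulr_ge0// decr0.
have Y0 : 0 <= Y by rewrite mulr_ge0// decr0.
have M0 : 0 <= M by apply: le_trans XM.
have f1 : flow gamma x (y + 1) = flow gamma x y * expR (- X).
  by rewrite /flow -expRD /X /decr; congr expR; ring.
have f2 : flow gamma (x + 1) (y + 1) = flow gamma x y * (expR (- X) * expR Y).
  by rewrite /flow -!expRD /X /Y /decr; congr expR; ring.
have b0 : 0 <= x / y by rewrite divr_ge0// ltW.
have b1 : x / y <= 1 by rewrite ler_pdivrMr// mul1r.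
set b := (x / y) ^+ d.
have bd0 : 0 <= b by rewrite exprn_ge0.
have bd1 : b <= 1 by rewrite exprn_ile1.
rewrite f1 f2.
have eX : expR (- X) * expR X = 1 by rewrite -expRD addNr expR0.
rewrite (_ : _ - _ = flow gamma x y * (expR (- X) * ((b * Y - X) + b * (expR Y - 1 - Y)
    - (expR X - 1 - X)))); last first.
  by rewrite -[X in _ - X]mulr1 -[X in _ - _ * X]eX; ring.
rewrite normrM ger0_norm ?expR_ge0//.
rewrite -[leRHS]mul1r ler_pM ?expR_ge0 ?flow_le1//.
rewrite normrM ger0_norm ?expR_ge0//.
rewrite -[leRHS]mul1r ler_pM ?expR_ge0//.
  by rewrite expR_le1 oppr_le0.
have ub z : 0 <= z <= M -> 0 <= expR z - 1 - z <= M ^+ 2 * expR M.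
  move=> /andP[z0 zM]; have /andP[-> h] /= := expR_sub_le z0.
  apply: le_trans h _; rewrite ler_pM ?sqr_ge0 ?expR_ge0 ?ler_expR//.
  by rewrite lerXn2r ?nnegrE.
have := ub X; rewrite X0 XM => /(_ isT) /andP[uX0 uX].
have := ub Y; rewrite Y0 YM => /(_ isT) /andP[uY0 uY].
have bYX : `|b * Y - X| <= D.
  apply: le_trans DD.
  have -> : b * Y - X = gamma / y ^+ d * (x ^+ d * decr x - y ^+ d * decr y).
    by rewrite /b /Y /X expr_div_n; field; rewrite expf_neq0// gt_eqF.
  have -> : gamma * e%:R ^+ 2 / (y ^+ d * x) = gamma / y ^+ d * (e%:R ^+ 2 / x).
    by field; rewrite gt_eqF// expf_neq0// gt_eqF.
  have gy : 0 <= gamma / y ^+ d by rewrite divr_ge0// exprn_ge0// ltW.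
  rewrite normrM (ger0_norm gy) ler_wpM2l//.
  have /andP[lx ux] := decr_bounds x0; have /andP[ly uy] := decr_bounds y0.
  have : e%:R ^+ 2 / y <= e%:R ^+ 2 / x by rewrite ler_wpM2l ?sqr_ge0// lef_pV2.
  by rewrite ler_norml => h; apply/andP; split; lra.
apply: le_trans (ler_normB _ _) _.
rewrite (ger0_norm uX0).
apply: le_trans (lerD (ler_normD _ _) (lexx _)) _.
have : `|b * (expR Y - 1 - Y)| <= M ^+ 2 * expR M.
  by rewrite ger0_norm ?mulr_ge0// (le_trans _ uY)// ler_piMl.
by move: uX bYX; lra.
Qed.

Definition flow_at (gamma : R) (k a : nat) : R := flow gamma (k - a)%:R k%:R.

(** M/n bounds the exponents gained in one step as long as k - a >= eta n. The first summand
    measures the defect of the first-order cancellation, the second the quadratic remainder. *)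
Definition flow_const (g eta : R) : R :=
  let M := g * e%:R * eta ^- d in g * e%:R ^+ 2 * eta ^- d.+1 + 2 * (M ^+ 2 * expR M).

Lemma flow_at_step_error (g eta : R) (n k a : nat) : 0 <= g -> 0 < eta -> (0 < n)%N ->
  (a <= k)%N -> eta * n%:R <= (k - a)%:R ->
  `|chain_step d k (flow_at (g * n%:R ^+ e) k.+1) a - flow_at (g * n%:R ^+ e) k a|
     <= flow_const g eta / n%:R ^+ 2.
Proof.
move=> g0 eta0 n0 ak Bn; set gamma := g * _.
have np : 0 < n%:R :> R by rewrite ltr0n.
have n1 : 1 <= n%:R :> R by rewrite ler1n.
set x : R := (k - a)%:R; set y : R := k%:R.
have en0 : 0 < eta * n%:R by rewrite mulr_gt0.
have x0 : 0 < x by apply: lt_le_trans Bn.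
have xy : x <= y by rewrite ler_nat leq_subr.
have y0 : 0 < y by apply: lt_le_trans xy.
have ga0 : 0 <= gamma by rewrite mulr_ge0// exprn_ge0.
pose M := g * e%:R * eta ^- d.
have M0 : 0 <= M by rewrite mulr_ge0 ?mulr_ge0// invr_ge0 exprn_ge0// ltW.
have dM z : eta * n%:R <= z -> gamma * decr z <= M / n%:R.
  move=> ez; have z0 : 0 < z by apply: lt_le_trans ez.
  have /andP[_ u] := decr_bounds z0.
  have zd : 0 < z ^+ d by rewrite exprn_gt0.
  have {u} u : decr z <= e%:R / z ^+ d by rewrite ler_pdivlMr// mulrC.
  apply: le_trans (ler_wpM2l ga0 u) _.
  apply: (@le_trans _ _ (gamma * (e%:R / (eta * n%:R) ^+ d))).
    rewrite ler_wpM2l// ler_wpM2l// lef_pV2 ?posrE ?exprn_gt0//.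
    by rewrite lerXn2r ?nnegrE ?(ltW en0) ?(ltW z0).
  rewrite le_eqVlt; apply/orP; left; apply/eqP.
  rewrite /gamma /M exprMn /d !exprS; field.
  by rewrite !gt_eqF ?exprn_gt0.
have Dn : gamma * e%:R ^+ 2 / (y ^+ d * x) <= g * e%:R ^+ 2 * eta ^- d.+1 / n%:R ^+ 2.
  apply: (@le_trans _ _ (gamma * e%:R ^+ 2 / (eta * n%:R) ^+ d.+1)).
    have p1 : 0 < (eta * n%:R) ^+ d.+1 by rewrite exprn_gt0.
    have p2 : 0 < y ^+ d * x by rewrite pmulr_lgt0// exprn_gt0.
    rewrite ler_wpM2l ?mulr_ge0 ?sqr_ge0// lef_pV2 ?posrE//.
    rewrite exprSr ler_pM ?exprn_ge0 ?(ltW en0)//.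
    by rewrite lerXn2r ?nnegrE ?(ltW en0) ?(ltW y0)// (le_trans Bn).
  rewrite le_eqVlt; apply/orP; left; apply/eqP.
  rewrite /gamma exprMn /d !exprS; field.
  by rewrite !gt_eqF ?exprn_gt0.
have := flow_step ga0 x0 xy (dM _ Bn) (dM _ (le_trans Bn xy)) Dn.
have -> : (x / y) ^+ d = miss_prob R d k a.
  by rewrite /miss_prob /x /y natrB// mulrBl divff// gt_eqF.
have xS : x + 1 = (k.+1 - a)%:R by rewrite /x natr1 subSn.
have yS : y + 1 = k.+1%:R by rewrite /y natr1.
rewrite xS yS /chain_step /flow_at subSS -/x -/y => h.
apply: le_trans h _.
rewrite /flow_const -/M [leRHS]mulrDl lerD2l -[leRHS]mulrA ler_wpM2l//.
rewrite expr_div_n mulrAC ler_wpM2r ?invr_ge0 ?sqr_ge0// ler_wpM2l ?sqr_ge0//.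
by rewrite ler_expR ler_piMr// invf_le1.
Qed.

(** A jump keeps k - a and a miss increases it, so the lower bound eta n persists up to time n
    without any stopping. Accordingly [psi] has to agree with the flow only where this bound
    holds. *)
Lemma flow_at_iter_error (g eta : R) (n k j a : nat) (psi : nat -> R) : 0 <= g -> 0 < eta ->
  (forall b, (b <= n)%N -> eta * n%:R <= (n - b)%:R -> psi b = flow_at (g * n%:R ^+ e) n b) ->
  (0 < k)%N -> (k + j)%N = n ->
  (a <= k)%N -> eta * n%:R <= (k - a)%:R ->
  `|chain_iter d k j psi a - flow_at (g * n%:R ^+ e) k a|
     <= j%:R * (flow_const g eta / n%:R ^+ 2).
Proof.
set gamma := g * _; move=> g0 eta0 psiE; elim: j k a => [|j IH] k a k0 kn ak Bn /=.
  by rewrite addn0 in kn; rewrite kn in ak Bn *; rewrite psiE// subrr normr0 mul0r.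
have n0 : (0 < n)%N by rewrite -kn ltn_addr.
set f := chain_iter _ _ _ _; set h := flow_at gamma k.+1; set C := _ / _ in IH *.
have fh : `|chain_step d k f a - chain_step d k h a| <= j%:R * C.
  have /andP[m0 m1] := @miss_prob_bounds R d k a k0 ak.
  have fa : `|f a - h a| <= j%:R * C.
    apply: IH; rewrite ?addSnnS ?leqW//.
    by rewrite (le_trans Bn)// ler_nat leq_sub2r.
  have fa1 : `|f a.+1 - h a.+1| <= j%:R * C.
    by apply: IH; rewrite ?addSnnS ?subSS.
  rewrite (_ : _ - _ = miss_prob R d k a * (f a - h a) + (1 - miss_prob R d k a) * (f a.+1 - h a.+1)); last first.
    by rewrite /chain_step; ring.
  apply: le_trans (ler_normD _ _) _.
  rewrite !normrM (ger0_norm m0) (@ger0_norm _ (1 - _)) ?subr_ge0//.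
  rewrite (_ : j%:R * C = miss_prob R d k a * (j%:R * C) + (1 - miss_prob R d k a) * (j%:R * C)); last by ring.
  by rewrite lerD// ler_wpM2l// subr_ge0.
rewrite (_ : _ - _ = (chain_step d k f a - chain_step d k h a) +
   (chain_step d k h a - flow_at gamma k a)); last by ring.
apply: le_trans (ler_normD _ _) _.
rewrite -natr1 mulrDl mul1r lerD//.
exact: flow_at_step_error.
Qed.

End Flow.

(** * Matching the two regimes *)

Section ChainLaplace.
Variables (R : realType) (e : nat).
Hypothesis e_gt0 : (0 < e)%N.
Let d := e.+1.

(* The value 0 at a >= n is the limit as b -> 0, which x / 0 = 0 would miss. *)
Definition laplace (g : R) (n a : nat) : R :=
  if (a < n)%N then expR (- (g * ((n%:R / (n - a)%:R) ^+ e - 1))) else 0.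

Lemma laplace_bounds g n a : 0 <= g -> 0 <= laplace g n a <= 1.
Proof.
move=> g0; rewrite /laplace; case: ltnP => an; last by rewrite lexx ler01.
have B0 : 0 < (n - a)%:R :> R by rewrite ltr0n subn_gt0.
rewrite expR_ge0 expR_le1 oppr_le0 mulr_ge0// subr_ge0 exprn_ege1//.
by rewrite ler_pdivlMr// mul1r ler_nat leq_subr.
Qed.

Lemma laplace_flow g n a : (a < n)%N -> laplace g n a = flow_at e (g * n%:R ^+ e) n a.
Proof.
move=> an; rewrite /laplace an /flow_at /flow; congr (expR (- _)).
have n0 : (0 < n)%N by apply: leq_ltn_trans an.
by rewrite expr_div_n; field; rewrite !expf_neq0// pnatr_eq0 -lt0n ?subn_gt0.
Qed.

(** From 1/(1 - u) = 1 + v with v <= u + 2 u^2 and v <= 2 u: the linear part of (1 + v)^e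
    contributes 2 e, the quadratic part 4 times 3^e. *)
Definition curve_const : R := 2 * e%:R + 4 * 3 ^+ e.

Lemma curve_const_ge0 : 0 <= curve_const.
Proof. by rewrite addr_ge0// mulr_ge0// exprn_ge0. Qed.

Lemma exprVB_bounds (u : R) : 0 <= u <= 2^-1 ->
  e%:R * u <= (1 - u) ^- e - 1 <= e%:R * u + curve_const * u ^+ 2.
Proof.
move=> /andP[u0 u1]; have u2 : 0 < 1 - u by lra.
pose v := u / (1 - u).
have v0 : 0 <= v by rewrite divr_ge0// ltW.
have v1 : v <= 2 * u.
  rewrite ler_pdivrMr//; have u3 : u * (2 * u) <= u * 1 by rewrite ler_wpM2l//; lra.
  by move: u3; lra.
have vE : v = u + u * v by rewrite /v; field; rewrite gt_eqF.
have v2 : v <= u + 2 * u ^+ 2.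
  by rewrite [leLHS]vE lerD2l expr2 (mulrCA 2) ler_wpM2l.
have -> : (1 - u) ^- e = (1 + v) ^+ e.
  by rewrite -exprVn; congr (_ ^+ _); rewrite /v; field; rewrite gt_eqF.
have v01 : 0 <= v <= 1 by rewrite v0 (le_trans v1)//; lra.
have uv : u <= v by rewrite [leRHS]vE lerDl mulr_ge0.
have := @bernoulli_ge R v e; have := expr1D_le e v01 => ub.
move=> /(_ (le_trans _ v0)); rewrite lerN10 => /(_ isT) lb.
have eu := ler_wpM2l (ler0n R e) uv.
have ev := ler_wpM2l (ler0n R e) v2.
have vv : 3 ^+ e * v ^+ 2 <= 3 ^+ e * (2 * u) ^+ 2.
  by rewrite ler_wpM2l ?exprn_ge0// lerXn2r// nnegrE mulr_ge0.
apply/andP; split; first by lra.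
rewrite (_ : (2 * u) ^+ 2 = 4 * u ^+ 2) in vv; last by ring.
by move: ub ev vv; rewrite /curve_const; clearbody v; lra.
Qed.

(** With z = c / k^d and c = g e n^e, both quantities are close to exp (- a z). In the flow, the
    curvature of (1 - u)^-e, u = a/k, changes the exponent X' = a z by a relative O(u), and X' exp
    (- X') <= 1 frees this error from g and n. The power (1 + z)^-a is off by at most a z^2. *)
Lemma flow_at_hit_weight_error g n k a : 0 <= g -> (0 < k)%N -> (a.*2 <= k)%N ->
  `|flow_at e (g * n%:R ^+ e) k a - hit_weight d (g * e%:R * n%:R ^+ e) k ^+ a|
    <= curve_const * (a%:R / k%:R) + k%:R * (g * e%:R * n%:R ^+ e / k%:R ^+ d) ^+ 2.
Proof.
move=> g0 k0 a2; set z := _ / k%:R ^+ d.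
have kp : 0 < k%:R :> R by rewrite ltr0n.
have ak : (a < k)%N.
  by rewrite -(ltn_pmul2l (isT : 0 < 2)%N) mul2n (leq_ltn_trans a2)// mul2n -addnn -ltn_subLR// subnn.
have z0 : 0 <= z by rewrite divr_ge0 ?exprn_ge0// mulr_ge0 ?mulr_ge0// exprn_ge0.
have hE : hit_weight d (g * e%:R * n%:R ^+ e) k = (1 + z)^-1.
  have K : 0 < k%:R ^+ d :> R by rewrite exprn_gt0.
  have z1 : 0 < 1 + z by rewrite ltr_wpDr.
  have -> : g * e%:R * n%:R ^+ e = z * k%:R ^+ d by rewrite divfK// gt_eqF.
  rewrite /hit_weight (_ : _ ^+ d + z * _ = k%:R ^+ d * (1 + z)); last by ring.
  by rewrite invfM mulrA divff ?mul1r// gt_eqF.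
set u : R := a%:R / k%:R.
have u01 : 0 <= u <= 2^-1.
  by rewrite divr_ge0//= ler_pdivrMr// mulrC ler_pdivlMr// -natrM ler_nat muln2.
have /andP[u0 u1] := u01.
have /andP[wl wu] := exprVB_bounds u01.
pose G := g * n%:R ^+ e / k%:R ^+ e.
have G0 : 0 <= G by rewrite divr_ge0 ?exprn_ge0// mulr_ge0// exprn_ge0.
have flE : flow_at e (g * n%:R ^+ e) k a = expR (- (G * ((1 - u) ^- e - 1))).
  have -> : 1 - u = (k - a)%:R / k%:R.
    by rewrite /u natrB ?(ltnW ak)// mulrBl divff// gt_eqF.
  rewrite /flow_at /flow /G; congr (expR (- _)).
  rewrite expr_div_n; field.
  by rewrite !expf_neq0// pnatr_eq0 -lt0n ?subn_gt0.
have zE : a%:R * z = G * (e%:R * u).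
  by rewrite /z /G /u /d exprS; field; rewrite expf_neq0 gt_eqF.
set X := G * ((1 - u) ^- e - 1) in flE.
set X' := G * (e%:R * u) in zE.
have X'0 : 0 <= X' by rewrite mulr_ge0// mulr_ge0.
have XX : X' <= X by rewrite ler_wpM2l.
have X2 : X - X' <= curve_const * u * X'.
  have -> : X - X' = G * ((1 - u) ^- e - 1 - e%:R * u) by rewrite /X /X'; ring.
  apply: (@le_trans _ _ (G * (curve_const * u ^+ 2))).
    by rewrite ler_wpM2l//; move: wu; lra.
  rewrite /X' (_ : _ * X' = G * (curve_const * u ^+ 2) * e%:R); last by rewrite /X'; ring.
  by rewrite ler_peMr ?ler1n// mulr_ge0// mulr_ge0 ?sqr_ge0// curve_const_ge0.
have d1 : 0 <= expR (- X') - expR (- X) <= curve_const * u.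
  rewrite subr_ge0 ler_expR lerN2 XX/=.
  have -> : expR (- X) = expR (- X') * expR (- (X - X')) by rewrite -expRD; congr expR; ring.
  have h1 := expR_ge1Dx (- (X - X')).
  apply: (@le_trans _ _ (expR (- X') * (X - X'))).
    by rewrite -[X in X - _]mulr1 -mulrBr ler_wpM2l ?expR_ge0//; move: h1; lra.
  apply: le_trans (ler_wpM2l (expR_ge0 _) X2) _.
  rewrite [leLHS](_ : _ = curve_const * u * (X' * expR (- X'))); last by ring.
  apply: ler_piMr; first by rewrite mulr_ge0// curve_const_ge0.
  exact: mul_expRN_le1.
have d2 : 0 <= (1 + z)^-1 ^+ a - expR (- X') <= k%:R * z ^+ 2.
  rewrite -zE subr_ge0 exprVn exprV1D_expR//=.
  have z1 : 0 < 1 + z by rewrite ltr_wpDr.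
  have h1 := expR_ge1Dx (- z); have h2 := inv1D_le z0.
  rewrite -exprVn -mulrN expRM_natl.
  apply: le_trans (exprB_le _ _ _) _.
  - rewrite expR_ge0 expRN lef_pV2 ?posrE ?expR_gt0//.
    exact: expR_ge1Dx.
  - by rewrite invf_le1// lerDl.
  apply: ler_pM => //.
  - rewrite subr_ge0 expRN lef_pV2 ?posrE ?expR_gt0//.
    exact: expR_ge1Dx.
  - by rewrite ler_nat ltnW.
  - by move: h1 h2; lra.
rewrite flE hE ler_norml.
by move: d1 d2 => /andP[? ?] /andP[? ?]; apply/andP; split; lra.
Qed.

Lemma flow_const_ge0 (g eta : R) : 0 <= g -> 0 <= eta -> 0 <= flow_const e g eta.
Proof.
move=> g0 e0; rewrite addr_ge0// mulr_ge0//.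
- by rewrite mulr_ge0// sqr_ge0.
- by rewrite invr_ge0 exprn_ge0.
- by rewrite mulr_ge0 ?sqr_ge0 ?expR_ge0.
Qed.

(** [chain_const] depends neither on g nor on the cut, since it multiplies a term that only a large
    q makes small. [chain_error] comes with a factor 1/n and may depend on both; there [rho] bounds
    n/k. *)
Definition chain_const : R := hit_weight_const R d + curve_const + 2.
Definition chain_error (g rho : R) : R :=
  flow_const e g (2 * rho)^-1 + (g * e%:R * rho ^+ e) ^+ 2 * rho.

Lemma chain_error_ge0 (g rho : R) : 0 <= g -> 0 < rho -> 0 <= chain_error g rho.
Proof.
move=> g0 r0; apply: addr_ge0; last by rewrite mulr_ge0 ?sqr_ge0 ?(ltW r0).
by apply: flow_const_ge0 => //; rewrite invr_ge0 mulr_ge0 ?(ltW r0).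
Qed.

Lemma chain_laplace_late g rho n k a : 0 <= g -> 0 < rho -> (0 < k)%N -> (k <= n)%N ->
  n%:R <= rho * k%:R -> (a <= k)%N ->
  `|chain_iter d k (n - k) (laplace g n) a - hit_weight d (g * e%:R * n%:R ^+ e) k ^+ a|
   <= (curve_const + 2) * (a%:R / k%:R) + chain_error g rho / n%:R.
Proof.
move=> g0 r0 k0 kn nk ak.
have n0 : (0 < n)%N by apply: leq_trans kn.
have np : 0 < n%:R :> R by rewrite ltr0n.
have kp : 0 < k%:R :> R by rewrite ltr0n.
set c := g * e%:R * n%:R ^+ e.
have c0 : 0 <= c by rewrite mulr_ge0 ?mulr_ge0// exprn_ge0.
have C0 := chain_error_ge0 g0 r0.
have K0 := curve_const_ge0.
(* If a > k/2, two numbers in [0, 1] differ by at most 2 a / k: this is the 2 in [chain_const].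
   Otherwise k - a >= k/2 >= n / (2 rho), the room that the flow needs. *)
have [a2|a2] := leqP a.*2 k; last first.
  apply: (@le_trans _ _ 1).
    have h01 : 0 <= chain_iter d k (n - k) (laplace g n) a <= 1.
      apply/andP; split.
        rewrite -[leLHS](@chain_iter_cst R d k (n - k) 0 a).
        by apply: chain_iter_le => // b _; have /andP[] := laplace_bounds n b g0.
      rewrite -[leRHS](@chain_iter_cst R d k (n - k) 1 a).
      by apply: chain_iter_le => // b _; have /andP[] := laplace_bounds n b g0.
    have /andP[s0 s1] := hit_weight_bounds d c0 k0.
    have : 0 <= hit_weight d c k ^+ a <= 1 by rewrite exprn_ge0// exprn_ile1.
    by move: h01 => /andP[? ?] /andP[? ?]; rewrite ler_norml; apply/andP; split; lra.
  have : 1 <= 2 * (a%:R / k%:R) :> R.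
    by rewrite mulrA ler_pdivlMr// mul1r -natrM ler_nat mul2n ltnW.
  have : 0 <= curve_const * (a%:R / k%:R) by rewrite mulr_ge0// divr_ge0.
  have : 0 <= chain_error g rho / n%:R by rewrite divr_ge0.
  by rewrite mulrDl; lra.
have e0 : 0 < (2 * rho)^-1 by rewrite invr_gt0 mulr_gt0.
have Bn : (2 * rho)^-1 * n%:R <= (k - a)%:R.
  apply: (@le_trans _ _ (k%:R / 2)).
    rewrite mulrC ler_pdivrMr ?mulr_gt0// [leRHS](_ : _ = rho * k%:R)//.
    by field.
  rewrite ler_pdivrMr// -natrM ler_nat muln2 doubleB leq_subRL; last by rewrite leq_double.
  by rewrite -(addnn k) leq_add2r.
have p2 := @flow_at_iter_error R e g (2 * rho)^-1 n k (n - k) a (laplace g n) g0 e0.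
have {}p2 := p2 _ k0 (subnKC kn) ak Bn.
have {}p2 : `|chain_iter d k (n - k) (laplace g n) a - flow_at e (g * n%:R ^+ e) k a|
    <= flow_const e g (2 * rho)^-1 / n%:R.
  apply: le_trans (p2 _) _.
    move=> b bn Bb; apply: laplace_flow.
    rewrite ltn_neqAle bn andbT; apply/eqP => bE; move: Bb; rewrite bE subnn.
    by rewrite leNgt mulr_gt0.
  rewrite [leLHS](_ : _ = ((n - k)%:R / n%:R) * (flow_const e g (2 * rho)^-1 / n%:R)); last first.
    by field; rewrite gt_eqF.
  rewrite ler_piMl//; first by rewrite divr_ge0// flow_const_ge0// ltW.
  by rewrite ler_pdivrMr// mul1r ler_nat leq_subr.
have j := flow_at_hit_weight_error n g0 k0 a2; rewrite -/c in j.
rewrite (_ : _ - _ = (chain_iter d k (n - k) (laplace g n) a - flow_at e (g * n%:R ^+ e) k a)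
   + (flow_at e (g * n%:R ^+ e) k a - hit_weight d c k ^+ a)); last by ring.
apply: le_trans (ler_normD _ _) _.
apply: le_trans (lerD p2 j) _.
have -> : (curve_const + 2) * (a%:R / k%:R) + chain_error g rho / n%:R =
  flow_const e g (2 * rho)^-1 / n%:R + (curve_const * (a%:R / k%:R) +
   (2 * (a%:R / k%:R) + (g * e%:R * rho ^+ e) ^+ 2 * rho / n%:R)).
  by rewrite /chain_error; ring.
rewrite lerD2l lerD2l.
rewrite ler_wpDl ?mulr_ge0 ?invr_ge0//.
have ne : n%:R ^+ e <= (rho * k%:R) ^+ e by rewrite lerXn2r ?nnegrE// mulr_ge0// ltW.
have zb : c / k%:R ^+ d <= g * e%:R * rho ^+ e / k%:R.
  rewrite ler_pdivrMr ?exprn_gt0//.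
  rewrite [leRHS](_ : _ = g * e%:R * (rho * k%:R) ^+ e).
    by rewrite ler_wpM2l// mulr_ge0.
  by rewrite /d exprS exprMn; field; rewrite gt_eqF.
apply: (@le_trans _ _ (k%:R * (g * e%:R * rho ^+ e / k%:R) ^+ 2)).
  rewrite ler_wpM2l// lerXn2r// nnegrE.
    by rewrite divr_ge0// exprn_ge0.
  by rewrite divr_ge0// mulr_ge0 ?mulr_ge0// exprn_ge0// ltW.
rewrite [leLHS](_ : _ = (g * e%:R * rho ^+ e) ^+ 2 / k%:R); last by field; rewrite gt_eqF.
rewrite -[leRHS]mulrA ler_wpM2l ?sqr_ge0//.
by rewrite -[leLHS]mul1r ler_pdivrMr// mulrAC ler_pdivlMr// mul1r.
Qed.

(** The late estimate is affine in the state at time k, so averaging it from m takes only the mean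
    (k/m)^d. The way from m to k is the Yule estimate. *)
Lemma chain_laplace g rho n k m : 0 <= g -> 0 < rho ->
  (0 < m)%N -> (m <= k)%N -> (k <= n)%N -> n%:R <= rho * k%:R ->
  `|chain_iter d m (n - m) (laplace g n) 1 - hit_weight d (g * e%:R * n%:R ^+ e) m|
   <= chain_const * (k%:R ^+ e / m%:R ^+ d) + chain_error g rho / n%:R.
Proof.
move=> g0 r0 m0 mk kn nk.
have k0 : (0 < k)%N by apply: leq_trans mk.
have kp : 0 < k%:R :> R by rewrite ltr0n.
have mp : 0 < m%:R :> R by rewrite ltr0n.
set c := g * e%:R * n%:R ^+ e.
have c0 : 0 <= c by rewrite mulr_ge0 ?mulr_ge0// exprn_ge0.
have K0 := curve_const_ge0.
have K1 := hit_weight_const_ge0 R d.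
rewrite (_ : (n - m)%N = ((k - m) + (n - k))%N); last by rewrite addnBAC// subnKC.
rewrite chain_iterD subnKC//.
set f := chain_iter d k _ _; set h := fun b => hit_weight d c k ^+ b.
have fh : `|chain_iter d m (k - m) f 1 - chain_iter d m (k - m) h 1|
    <= (curve_const + 2) * (k%:R ^+ e / m%:R ^+ d) + chain_error g rho / n%:R.
  rewrite -chain_iter_sub.
  apply: (@le_trans _ _ (chain_iter d m (k - m)
     (fun b => (curve_const + 2) / k%:R * b%:R + (chain_error g rho / n%:R)) 1)).
    apply: chain_iter_norm => // b /andP[_]; rewrite subnKC// => bk.
    by apply: le_trans (chain_laplace_late _ r0 _ _ _ _) _ => //; rewrite mulrAC mulrA.
  rewrite (chain_iter_lin d m (k - m) ((curve_const + 2) / k%:R) (fun b => b%:R)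
     (fun=> chain_error g rho / n%:R)) chain_iter_cst lerD2r.
  rewrite -mulrA ler_wpM2l ?addr_ge0//.
  have := @chain_iter_mean R d m (k - m) 1 m0 m0; rewrite subnKC// mul1r => h1.
  rewrite mulrC ler_pdivrMr//; apply: le_trans h1 _.
  by rewrite expr_div_n mulrAC -exprSr.
have p1 := @hit_weight_iter_error R d (_ : 1 < d)%N c m (k - m) 1 c0 m0 m0.
rewrite subnKC// expr1 mulr1 in p1.
have {}p1 : `|chain_iter d m (k - m) h 1 - hit_weight d c m| <=
   hit_weight_const R d * (k%:R ^+ e / m%:R ^+ d).
  apply: le_trans (p1 _) _; first by rewrite /d ltnS.
  rewrite ler_wpM2l// ler_wpM2r ?invr_ge0 ?exprn_ge0//.
  have -> : k%:R ^+ e = k%:R * k%:R ^+ (d - 2) :> R.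
    by rewrite -exprS /d subSS subn1 prednK.
  by rewrite ler_wpM2r ?exprn_ge0// ler_nat leq_subr.
rewrite (_ : _ - _ = (chain_iter d m (k - m) f 1 - chain_iter d m (k - m) h 1)
   + (chain_iter d m (k - m) h 1 - hit_weight d c m)); last by ring.
apply: le_trans (ler_normD _ _) _.
apply: le_trans (lerD fh p1) _.
rewrite /chain_const; set X := _ / m%:R ^+ d; lra.
Qed.

(** Linearity in a/n lets the first moment control the average; linearity in g makes the result
    integrable against a Gamma density. *)
Lemma laplace_ge g n a : 0 <= g -> (0 < n)%N -> (a <= n)%N ->
  1 - laplace g n a <= ((e%:R + curve_const) * g + 2) * (a%:R / n%:R).
Proof.
move=> g0 n0 an; have np : 0 < n%:R :> R by rewrite ltr0n.
have K0 := curve_const_ge0.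
set u : R := a%:R / n%:R; have u0 : 0 <= u by rewrite divr_ge0.
have gu : 0 <= (e%:R + curve_const) * g * u by rewrite mulr_ge0 ?mulr_ge0 ?addr_ge0.
have [a2|a2] := leqP a.*2 n; last first.
  have /andP[l0 _] := laplace_bounds n a g0.
  have : 1 <= 2 * u.
    by rewrite mulrA ler_pdivlMr// mul1r -natrM ler_nat mul2n ltnW.
  by rewrite mulrDl; lra.
have an' : (a < n)%N.
  by rewrite -(ltn_pmul2l (isT : 0 < 2)%N) mul2n (leq_ltn_trans a2)// mul2n -addnn -ltn_subLR// subnn.
have u01 : 0 <= u <= 2^-1.
  by rewrite u0/= ler_pdivrMr// mulrC ler_pdivlMr// -natrM ler_nat muln2.
have /andP[wl wu] := exprVB_bounds u01.
have /andP[_ u1] := u01.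
rewrite /laplace an'.
have -> : n%:R / (n - a)%:R = (1 - u)^-1.
  have Bp : 0 < (n - a)%:R :> R by rewrite ltr0n subn_gt0.
  by rewrite /u; rewrite natrB// in Bp *; field; rewrite gt_eqF//= gt_eqF.
rewrite exprVn; set w := _ - 1 in wl wu *.
have h := expR_ge1Dx (- (g * w)).
have uu : u ^+ 2 <= u by rewrite expr2 ler_piMl//; lra.
have w2 : w <= (e%:R + curve_const) * u.
  by have := ler_wpM2l K0 uu; move: wu; lra.
have := ler_wpM2l g0 w2; move: h; rewrite !mulrDl; lra.
Qed.

(** A bound without any cut, for the targets m comparable to n and for the domination of the sums
    over m. *)
Lemma chain_laplace_ge g n m : 0 <= g -> (0 < m)%N -> (m <= n)%N ->
  1 - chain_iter d m (n - m) (laplace g n) 1 <=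
  ((e%:R + curve_const) * g + 2) * (n%:R ^+ e / m%:R ^+ d).
Proof.
move=> g0 m0 mn; have n0 : (0 < n)%N by apply: leq_trans mn.
have np : 0 < n%:R :> R by rewrite ltr0n.
set C := _ + 2; have C0 : 0 <= C by rewrite addr_ge0// mulr_ge0// addr_ge0// curve_const_ge0.
rewrite -[X in X - _](@chain_iter_cst R d m (n - m) 1 1) -chain_iter_sub.
apply: (@le_trans _ _ (chain_iter d m (n - m) (fun a => C / n%:R * a%:R) 1)).
  apply: chain_iter_le => // b /andP[_]; rewrite subnKC// => bn.
  by rewrite mulrAC -mulrA laplace_ge.
rewrite chain_iterZ -mulrA ler_wpM2l//.
have := @chain_iter_mean R d m (n - m) 1 m0 m0; rewrite subnKC// mul1r => h1.
rewrite mulrC ler_pdivrMr//; apply: le_trans h1 _.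
by rewrite expr_div_n mulrAC -exprSr.
Qed.

End ChainLaplace.

(** * Summation over the target vertex *)

Section SumLaplace.
Variables (R : realType) (e : nat).
Hypothesis e_gt0 : (0 < e)%N.
Let d := e.+1.
Let d_gt1 : (1 < d)%N. Proof. by rewrite /d ltnS. Qed.
Let alpha : R := (d%:R - 1) / d%:R.
Notation I := (@root_integral R d).

Definition laplace_mean (g : R) (n m : nat) : R := chain_iter d m (n - m) (laplace e g n) 1.

Definition scaled_sum (g : R) (n : nat) : R :=
  n%:R `^ (- alpha) * \sum_(m < n) (1 - laplace_mean g n m.+1).

Let A (g : R) : R := (e%:R + curve_const R e) * g + 2.

Lemma laplace_mean_bounds (g : R) n m : 0 <= g -> (0 < m)%N -> 0 <= laplace_mean g n m <= 1.
Proof.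
move=> g0 m0; apply/andP; split.
  rewrite -[leLHS](@chain_iter_cst R d m (n - m) 0 1).
  by apply: chain_iter_le => // b _; have /andP[] := laplace_bounds e n b g0.
rewrite -[leRHS](@chain_iter_cst R d m (n - m) 1 1).
by apply: chain_iter_le => // b _; have /andP[] := laplace_bounds e n b g0.
Qed.

(** Replaces min(1, y/w) by the summand of the Riemann sum. *)
Lemma le_double_fraction (x y w : R) : 0 < w -> 0 <= y -> x <= 1 -> x <= y / w ->
  x <= 2 * (y / (w + y)).
Proof.
move=> w0 y0 x1 xy; have wy : 0 < w + y by rewrite ltr_wpDr.
rewrite mulrA ler_pdivlMr// mulrDr.
have h1 : x * w <= y by rewrite -ler_pdivlMr.
have h2 : x * y <= y by rewrite ler_piMl.
lra.
Qed.

Lemma A_ge1 (g : R) : 0 <= g -> 1 <= A g.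
Proof.
move=> g0; have : 0 <= (e%:R + curve_const R e) * g.
  by rewrite mulr_ge0// addr_ge0// curve_const_ge0.
by rewrite /A; lra.
Qed.

Lemma scaled_sum_ge0 (g : R) n : 0 <= g -> 0 <= scaled_sum g n.
Proof.
move=> g0; rewrite mulr_ge0 ?powR_ge0// sumr_ge0// => m _; rewrite subr_ge0.
by have /andP[] := @laplace_mean_bounds g n m.+1 g0 isT.
Qed.

Lemma scaled_fraction_sum (c : R) (n : nat) : 0 < c -> (0 < n)%N ->
  n%:R `^ (- alpha) * \sum_(m < n) (c * n%:R ^+ e) / (m.+1%:R ^+ d + c * n%:R ^+ e)
    <= c `^ d%:R^-1 * I.
Proof.
move=> c0 n0; have np : 0 < n%:R :> R by rewrite ltr0n.
have y0 : 0 < c * n%:R ^+ e by rewrite mulr_gt0// exprn_gt0.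
have := @sum_root_fraction_ub R d d_gt1 _ n y0.
have := @powRn_fraction R d d_gt1 c n (ltW c0); rewrite -[d.-1]/e => ->.
move=> /(ler_wpM2l (powR_ge0 n%:R (- alpha))) /le_trans; apply.
rewrite powRN [leLHS](_ : _ = c `^ d%:R^-1 * I * ((n%:R `^ alpha)^-1 * n%:R `^ alpha)).
  by rewrite mulVf ?mulr1// gt_eqF// powR_gt0.
by rewrite /alpha; ring.
Qed.

(** Made for dominated convergence in g: it is uniform in n, and A^(1/d) is weakened to A, which is
    at least 1, to be linear in g. *)
Lemma scaled_sum_ub (g : R) n : 0 <= g -> (0 < n)%N -> scaled_sum g n <= 2 * I * A g.
Proof.
move=> g0 n0; have A1 := A_ge1 g0; have A0 : 0 < A g by lra.
have I0 := root_integral_gt0 R d_gt1.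
apply: (@le_trans _ _ (2 * (A g `^ d%:R^-1 * I))); last first.
  rewrite -mulrA ler_pM2l// mulrC ler_pM2l//.
  by rewrite -[leRHS]powRr1 ?(ltW A0)// ler_powR// invf_le1 ?ler1n ?ltr0n.
apply: le_trans (ler_wpM2l _ (scaled_fraction_sum A0 n0)) => //.
rewrite mulrCA /scaled_sum ler_wpM2l ?powR_ge0// mulr_sumr ler_sum// => m _.
have /andP[l0 l1] := @laplace_mean_bounds g n m.+1 g0 isT.
apply: le_double_fraction.
- by rewrite exprn_gt0.
- by rewrite mulr_ge0 ?exprn_ge0// ltW.
- by lra.
- by rewrite -mulrA; apply: chain_laplace_ge.
Qed.

(** Targets m <= n/q go through both regimes with the cut at n/q. For larger m both quantities are
    within A n^e / m^d of 1, which is O(1/n) for fixed q. *)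
Lemma laplace_mean_error (g : R) q n m : 0 < g -> (0 < q)%N -> (q <= n)%N -> (0 < m)%N -> (m <= n)%N ->
  `|laplace_mean g n m - hit_weight d (g * e%:R * n%:R ^+ e) m| <=
    2 * (chain_const R e * (n%:R / q%:R) ^+ e / (m%:R ^+ d + chain_const R e * (n%:R / q%:R) ^+ e)) +
    (chain_error e g (2 * q%:R) + A g * (2 * q%:R) ^+ d) / n%:R.
Proof.
move=> g0 q0 qn m0 mn; have g0' := ltW g0.
have n0 : (0 < n)%N by apply: leq_trans mn.
have np : 0 < n%:R :> R by rewrite ltr0n.
have qp : 0 < q%:R :> R by rewrite ltr0n.
have mp : 0 < m%:R :> R by rewrite ltr0n.
have md : 0 < m%:R ^+ d :> R by rewrite exprn_gt0.
have q2 : 0 < 2 * q%:R :> R by rewrite mulr_gt0.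
have C0 : 0 < chain_const R e.
  by rewrite ltr_wpDl// addr_ge0 ?hit_weight_const_ge0 ?curve_const_ge0.
have E0 := chain_error_ge0 e g0' q2.
have A1 := A_ge1 g0'.
set c := g * e%:R * n%:R ^+ e.
have c0 : 0 <= c by rewrite mulr_ge0 ?mulr_ge0// exprn_ge0.
have /andP[l0 l1] := @laplace_mean_bounds g n m g0' m0.
have /andP[s0 s1] := hit_weight_bounds d c0 m0.
set y := _ * _ ^+ e; have y0 : 0 < y by rewrite mulr_gt0// exprn_gt0// divr_gt0.
(* Rounding down costs a factor 2: n < (k + 1) q <= 2 k q, whence rho = 2 q. *)
set k := (n %/ q)%N.
have kn : (k <= n)%N by exact: leq_div.
have kq : (k * q <= n)%N by exact: leq_trunc_div.
have k0 : (0 < k)%N by rewrite divn_gt0.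
have nk : n%:R <= 2 * q%:R * k%:R :> R.
  rewrite -!natrM ler_nat.
  have : (n < k.+1 * q)%N by rewrite ltn_ceil.
  rewrite mulSn => h; apply: (leq_trans (ltnW h)).
  by rewrite -mulnA mulnC mulnC mulSn mul1n (mulnC k q) leq_add2r leq_pmulr.
have An : 0 <= A g * (2 * q%:R) ^+ d / n%:R.
  by rewrite !mulr_ge0// ?invr_ge0 ?exprn_ge0// ?ltW//; lra.
have En : 0 <= chain_error e g (2 * q%:R) / n%:R by rewrite divr_ge0.
have F0 : 0 <= y / (m%:R ^+ d + y) by rewrite divr_ge0 ?addr_ge0 ?ltW.
have n1 : `|laplace_mean g n m - hit_weight d c m| <= 1.
  by rewrite ler_norml; apply/andP; split; lra.
rewrite [X in _ <= _ + X]mulrDl.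
have [mk|km] := leqP m k.
  have h := chain_laplace e_gt0 g0' q2 m0 mk kn nk.
  have {}h : `|laplace_mean g n m - hit_weight d c m| - chain_error e g (2 * q%:R) / n%:R <= y / m%:R ^+ d.
    rewrite lerBlDr; apply: le_trans h _; rewrite lerD2r.
    rewrite mulrA ler_wpM2r ?invr_ge0 ?(ltW md)// ler_wpM2l ?(ltW C0)//.
    rewrite lerXn2r ?nnegrE// ?divr_ge0//.
    by rewrite ler_pdivlMr// -natrM ler_nat.
  have := le_double_fraction md (ltW y0) (_ : _ <= 1) h; lra.
apply: (@le_trans _ _ (A g * (2 * q%:R) ^+ d / n%:R)); last by lra.
apply: (@le_trans _ _ (A g * (n%:R ^+ e / m%:R ^+ d))); last first.
  rewrite -mulrA ler_wpM2l ?(le_trans ler01)//.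
  rewrite ler_pdivrMr// mulrAC ler_pdivlMr// -exprSr -exprMn.
  rewrite lerXn2r ?nnegrE ?mulr_ge0 ?(ltW q2)//.
  by apply: le_trans nk _; rewrite ler_wpM2l ?(ltW q2)// ler_nat ltnW.
have l2 := @chain_laplace_ge R e g n m g0' m0 mn.
rewrite -/(A g) -/(laplace_mean g n m) in l2.
have s2 : 1 - hit_weight d c m <= A g * (n%:R ^+ e / m%:R ^+ d).
  have -> : 1 - hit_weight d c m = c / (m%:R ^+ d + c).
    by rewrite /hit_weight; field; rewrite gt_eqF// ltr_wpDr.
  apply: (@le_trans _ _ (c / m%:R ^+ d)).
    by rewrite ler_wpM2l// lef_pV2 ?posrE ?ltr_wpDr// lerDl.
  rewrite mulrA ler_wpM2r ?invr_ge0 ?(ltW md)// ler_wpM2r ?exprn_ge0//.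
  have : 0 <= curve_const R e * g by rewrite mulr_ge0// curve_const_ge0.
  by move=> h; rewrite /A mulrDl -addrA mulrC lerDl addr_ge0.
by rewrite ler_norml; apply/andP; split; lra.
Qed.

Lemma scaled_sum_cvg (g : R) : 0 < g -> scaled_sum g n @[n --> \oo] --> (g * e%:R) `^ d%:R^-1 * I.
Proof.
move=> g0.
have ge0 : 0 < g * e%:R by rewrite mulr_gt0// ltr0n.
have I0 := root_integral_gt0 R d_gt1.
have main := cvg_sum_root_fraction d_gt1 ge0.
rewrite -[d.-1]/e in main.
pose S n : R := n%:R `^ (- ((d%:R - 1) / d%:R)) *
  (\sum_(m < n) g * e%:R * n%:R ^+ e / (m.+1%:R ^+ d + g * e%:R * n%:R ^+ e)).
suff : scaled_sum g n - S n @[n --> \oo] --> 0.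
  move=> /cvgD /(_ main); rewrite add0r.
  by under eq_cvg do rewrite /= subrK.
apply/cvgr0Pnorm_le => eps eps0.
have C0 : 0 < chain_const R e.
  by rewrite ltr_wpDl// addr_ge0 ?hit_weight_const_ge0 ?curve_const_ge0.
pose K := 2 * chain_const R e `^ d%:R^-1 * I.
have K0 : 0 < K by apply: mulr_gt0 => //; apply: mulr_gt0 => //; exact: powR_gt0.
(* q is fixed first: the fractions in the error bound, summed over m and scaled, give at most [K]
   q^(-alpha) for all n >= q. The n remaining terms D/n then give only D n^(-alpha). *)
have [q q0 qK] : exists2 q : nat, (0 < q)%N & K * q%:R `^ (- alpha) <= eps / 2.
  have : K * q%:R `^ (- alpha) @[q --> \oo] --> K * 0.
    by apply: cvgMl_tmp; apply: cvgn_powRN0; exact: alpha_gt0.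
  rewrite mulr0 => /cvgr_le /(_ (eps / 2)); rewrite divr_gt0// => /(_ isT) h.
  have [q] := @filter_ex _ _ _ _ (filterI h (nbhs_infty_gt 0%N)).
  by move=> [qK q0]; exists q.
pose D := chain_error e g (2 * q%:R) + A g * (2 * q%:R) ^+ d.
have : D * n%:R `^ (- alpha) @[n --> \oo] --> D * 0.
  by apply: cvgMl_tmp; apply: cvgn_powRN0; exact: alpha_gt0.
rewrite mulr0 => /cvgr_le /(_ (eps / 2)); rewrite divr_gt0// => /(_ isT) hD.
near=> n.
have n0 : (0 < n)%N by near: n; exact: nbhs_infty_gt.
have np : 0 < n%:R :> R by rewrite ltr0n.
have qn : (q <= n)%N by near: n; exact: nbhs_infty_ge.
have Dn : D * n%:R `^ (- alpha) <= eps / 2 by near: n.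
rewrite /S -/alpha -mulrBr -sumrB normrM ger0_norm ?powR_ge0//.
apply: (@le_trans _ _ (K * q%:R `^ (- alpha) + D * n%:R `^ (- alpha))); last by lra.
pose c := chain_const R e / q%:R ^+ e.
have c0 : 0 < c by rewrite divr_gt0// exprn_gt0// ltr0n.
apply: (@le_trans _ _ (n%:R `^ (- alpha) *
  (\sum_(m < n) (2 * (c * n%:R ^+ e / (m.+1%:R ^+ d + c * n%:R ^+ e)) + D / n%:R)))).
  rewrite ler_wpM2l ?powR_ge0//; apply: le_trans (ler_norm_sum _ _ _) _.
  apply: ler_sum => m _.
  have := laplace_mean_error g0 q0 qn (isT : (0 < m.+1)%N) (ltn_ord m).
  have -> : chain_const R e * (n%:R / q%:R) ^+ e = c * n%:R ^+ e.
    by rewrite expr_div_n /c mulrAC mulrA.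
  move=> /= h; apply: le_trans h.
  rewrite -normrN le_eqVlt; apply/orP; left; apply/eqP; congr (`| _ |).
  rewrite /hit_weight.
  have : m.+1%:R ^+ d + g * e%:R * n%:R ^+ e != 0.
    by rewrite gt_eqF// addr_gt0 ?exprn_gt0// mulr_gt0// exprn_gt0.
  by move=> ?; field.
rewrite big_split/= sumr_const card_ord -mulr_sumr mulrDr lerD//.
  rewrite mulrCA; apply: le_trans (ler_wpM2l _ (scaled_fraction_sum c0 n0)) _ => //.
  rewrite /K [leRHS](_ : _ = 2 * (chain_const R e `^ d%:R^-1 * q%:R `^ (- alpha) * I)); last by ring.
  rewrite ler_pM2l// ler_pM2r// /c powRM ?(ltW C0) ?invr_ge0 ?exprn_ge0//.
  rewrite ler_pM2l ?powR_gt0// -powR_invn// -powRrM mulNr.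
  by rewrite /alpha /d -[e.+1%:R]natr1 addrK.
by rewrite -[(_ / _) *+ n]mulr_natr divfK ?gt_eqF// mulrC.
Unshelve. all: by end_near.
Qed.

End SumLaplace.

(** * Gamma integrals *)

Section GammaIntegral.
Variable R : realType.
Notation mu := (@lebesgue_measure R).
Notation D := (`]0%R, +oo[%classic : set R).

Definition gamma_density (r t : R) : R := t `^ (r - 1) * expR (- t).

Lemma measurable_gamma_density r : measurable_fun D (gamma_density r).
Proof.
apply: measurable_funTS; apply: measurable_funM; first exact: measurable_powR.
by apply: measurableT_comp => //; exact: measurableT_comp.
Qed.

Lemma gamma_density_ge0 r t : 0 <= gamma_density r t.
Proof. by rewrite mulr_ge0 ?powR_ge0 ?expR_ge0. Qed.

Lemma powR_le_expR (a : R) : 0 <= a ->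
  exists2 C : R, 0 < C & forall t, 0 < t -> t `^ a <= C * expR (t / 2).
Proof.
move=> a0; pose N := (Num.truncn a).+1.
have aN : a <= N%:R by apply: ltW; rewrite /N truncnS_gt.
exists (1 + 2 ^+ N * N`!%:R).
  by rewrite ltr_wpDr// mulr_ge0// exprn_ge0.
move=> t t0; have t20 : 0 <= t / 2 by rewrite divr_ge0// ltW.
apply: (@le_trans _ _ (1 + t ^+ N)).
  have [t1|t1] := leP t 1.
    apply: (@le_trans _ _ 1); last by rewrite lerDl exprn_ge0// (ltW t0).
    rewrite -[leRHS](powRr0 t); apply: ger_powR => //.
    by rewrite t0 t1.
  apply: (@le_trans _ _ (t ^+ N)); last by rewrite lerDr.
  by rewrite -(powR_mulrn _ (ltW t0)) ler_powR// (ltW t1).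
have h := expR_ge1Dxn N.-1 t20.
rewrite mulrDl mul1r lerD//; first by apply: le_trans (expR_ge1Dx _); rewrite lerDl.
have F0 : 0 < N`!%:R :> R by rewrite ltr0n fact_gt0.
have h2 : (t / 2) ^+ N / N`!%:R <= expR (t / 2) by apply: le_trans h; rewrite lerDr.
rewrite ler_pdivrMr// in h2.
apply: (@le_trans _ _ (2 ^+ N * (t / 2) ^+ N)).
  by rewrite -exprMn mulrC divfK.
by rewrite -mulrA ler_wpM2l ?exprn_ge0// (mulrC _ (expR _)).
Qed.

(** Half of the exponential decay absorbs the power; what is left is a multiple of the exponential
    density of rate 1/2. *)
Lemma integrable_gamma_density r : 1 <= r -> mu.-integrable D (EFin \o gamma_density r).
Proof.
move=> r1; have [|C C0 HC] := @powR_le_expR (r - 1); first by rewrite subr_ge0.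
have i1 : mu.-integrable D (EFin \o (fun t => 2 * C * exponential_pdf 2^-1 t)).
  have -> : EFin \o (fun t => 2 * C * exponential_pdf 2^-1 t) =
    (fun t => (2 * C)%:E * (EFin \o exponential_pdf 2^-1) t)%E by [].
  apply: integrableZl => //.
  apply: (integrableS measurableT) => //.
  by apply: integrable_exponential_pdf; rewrite invr_gt0.
apply: le_integrable i1 => //.
  by apply/measurable_EFinP; exact: measurable_gamma_density.
move=> t /=; rewrite in_itv/= andbT => t0.
rewrite lee_fin !ger0_norm ?gamma_density_ge0//; last first.
  by rewrite !mulr_ge0 ?(ltW C0) ?exponential_pdf_ge0.
rewrite exponential_pdfE ?(ltW t0)// /gamma_density.
apply: le_trans (ler_wpM2r (expR_ge0 _) (HC t t0)) _.
rewrite -[leLHS]mulrA -expRD (_ : t / 2 - t = - 2^-1 * t); last by field.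
rewrite [leRHS](_ : _ = C * expR (- 2^-1 * t))//.
by field.
Qed.

(** [fine] sends an infinite integral to 0, so positivity takes finiteness besides the mass on
    [1, 2], where the density is at least exp (-2). *)
Lemma Gamma_gt0 (r : R) : 1 <= r -> 0 < Gamma r.
Proof.
move=> r1; have ig := integrable_gamma_density r1.
have i12 : `[1%R, 2%R] `<=` D.
  by move=> x /=; rewrite !in_itv/= => /andP[x1 _]; rewrite (lt_le_trans _ x1).
have mg := measurable_gamma_density r.
have h : ((expR (- 2))%:E <= \int[mu]_(t in D) (gamma_density r t)%:E)%E.
  apply: (@le_trans _ _ (\int[mu]_(t in `[1%R, 2%R]) (gamma_density r t)%:E)%E); last first.
    apply: ge0_subset_integral => //.
    - by apply/measurable_EFinP.
    - by move=> t _; rewrite lee_fin gamma_density_ge0.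
  apply: (@le_trans _ _ (\int[mu]_(t in `[1%R, 2%R]) (cst (expR (- 2))%:E t))%E).
    rewrite integral_cst//= lebesgue_measure_itv/= lte_fin ltr1n/=.
    by rewrite -EFinD (_ : 2 - 1 = 1 :> R) ?mule1//; ring.
  apply: ge0_le_integral => //.
  - by move=> t _; rewrite lee_fin expR_ge0.
  - by apply/measurable_EFinP; exact: measurable_funS mg.
  move=> t /=; rewrite in_itv/= => /andP[t1 t2]; rewrite lee_fin.
  rewrite /gamma_density -[leLHS]mul1r ler_pM ?expR_ge0 ?ler_expR ?lerN2//.
  by rewrite -[leLHS](powRr0 t) ler_powR// subr_ge0.
rewrite /Gamma /Rintegral fine_gt0//; apply/andP; split.
  by apply: lt_le_trans h; rewrite lte_fin expR_gt0.
have /integrableP[_] := ig; apply: le_lt_trans.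
by apply: ge0_le_integral => //=; [move=> t _; rewrite lee_fin gamma_density_ge0
  |exact/measurable_EFinP|apply/measurable_EFinP; exact: measurableT_comp
  |move=> t _; rewrite lee_fin ler_norm].
Qed.

(** Substitution of v t for t. For r > 1 the integrand tends to 0 at 0, which gives the continuity
    on the closed half-line that the change of variables asks for. *)
Lemma Gamma_scale (r v : R) : 1 < r -> 0 < v ->
  \int[mu]_(t in D) (t `^ (r - 1) * expR (- (v * t))) = v `^ (- r) * Gamma r.
Proof.
move=> r1 v0.
have a0 : 0 < r - 1 by rewrite subr_gt0.
pose F (x : R) := v * x.
have dF (x : R) : is_derive x 1 F v.
  by apply: is_derive_eq; rewrite /GRing.scale/= mulr1.
have F'E : F^`()%classic = cst v.
  by apply/funext => x; rewrite derive1E; have [_ ->] := dF x.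
have F0 : F 0 = 0 by rewrite /F mulr0.
have mg := measurable_gamma_density r.
have mF : measurable_fun setT F by apply: measurable_funM.
have cF : continuous F.
  by move=> x; apply/differentiable_continuous/derivable1_diffP; exact: ex_derive.
have cexpN (x : R) : expR (- y) @[y --> x] --> expR (- x).
  by apply: continuous_comp; [exact: continuousN|exact: continuous_expR].
have sub : (\int[mu]_(x in `[F 0%R, +oo[) (gamma_density r x)%:E =
    \int[mu]_(x in `[0%R, +oo[) (((gamma_density r \o F) * F^`()%classic) x)%:E)%E.
  apply: increasing_ge0_integration_by_substitutiony.
  - by move=> x y _ _ xy; rewrite /F ltr_pM2l.
  - by rewrite F'E => x _; exact: cst_continuous.
  - by rewrite F'E; exact: is_cvg_cst.
  - by rewrite F'E; exact: is_cvg_cst.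
  - split; first by move=> x _; exact: ex_derive.
    by apply: cvg_at_right_filter; exact: cF.
  - by apply: gt0_cvgMry => //; exact: cvg_id.
  - rewrite F0; apply/continuous_within_itvcyP; split.
      move=> x x0; apply: cvgM; last exact: cexpN.
      have /derivable1_diffP/differentiable_continuous := @derivable_powR R 1 (r - 1) x x0.
      exact.
    rewrite /gamma_density powR0 ?gt_eqF// mul0r -[X in _ --> X](mul0r (expR (- 0))).
    apply: cvgM; first exact: powR_cvg0.
    by apply: cvg_at_right_filter; exact: cexpN.
  - by move=> x _; exact: gamma_density_ge0.
have mD : measurable D by [].
have E2 : (\int[mu]_(t in D) (t `^ (r - 1) * expR (- (v * t)))%:E =
   (v `^ (- r))%:E * \int[mu]_(t in D) (gamma_density r t)%:E)%E.
  rewrite [in RHS]integral_itv_obnd_cbnd; last by apply/measurable_EFinP.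
  rewrite F0 in sub; rewrite sub -integral_itv_obnd_cbnd; last first.
    apply/measurable_EFinP; rewrite F'E; apply: measurable_funM => //.
    apply: (measurable_comp mD) => //.
      by move=> _ [x /= + <-]; rewrite !in_itv/= !andbT => x0; rewrite mulr_gt0.
    exact: measurable_funTS.
  rewrite -ge0_integralZl_EFin ?powR_ge0//; last 2 first.
  - by move=> x _; rewrite lee_fin F'E/= mulr_ge0 ?gamma_density_ge0// ltW.
  - apply/measurable_EFinP; rewrite F'E; apply: measurable_funM => //.
    apply: (measurable_comp mD) => //.
      by move=> _ [x /= + <-]; rewrite !in_itv/= !andbT => x0; rewrite mulr_gt0.
    exact: measurable_funTS.
  apply: eq_integral => t; rewrite inE/= in_itv/= andbT => t0.
  rewrite F'E -EFinM; congr EFin.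
  rewrite [X in _ = _ * X](_ : _ = gamma_density r (F t) * v)// /gamma_density /F powRM ?(ltW v0) ?(ltW t0)//.
  have vr : v `^ r = v `^ (r - 1) * v.
    by rewrite -[X in _ * X]powRr1 ?(ltW v0)// -powRD ?subrK// (gt_eqF v0) implybT.
  rewrite powRN vr; field.
  by rewrite !gt_eqF// powR_gt0.
rewrite /Gamma /Rintegral E2 fineM//.
by apply: integrable_fin_num => //; exact: integrable_gamma_density (ltW r1).
Qed.

End GammaIntegral.

(** * Recovering the powers of b by a Gamma mixture *)

Section Mixture.
Variables (R : realType) (e : nat).
Hypothesis e_gt0 : (0 < e)%N.
Let d := e.+1.
Let d_gt1 : (1 < d)%N. Proof. by rewrite /d ltnS. Qed.
Let alpha : R := (d%:R - 1) / d%:R.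
Notation mu := (@lebesgue_measure R).
Notation D := (`]0%R, +oo[%classic : set R).
Notation I := (@root_integral R d).

Lemma integrable_EFinZ (c : R) (f : R -> R) : mu.-integrable D (EFin \o f) ->
  mu.-integrable D (EFin \o (fun x => c * f x)).
Proof. by move=> i; apply: (integrableZl _ c i). Qed.

Lemma integrable_EFinD (f h : R -> R) : mu.-integrable D (EFin \o f) ->
  mu.-integrable D (EFin \o h) -> mu.-integrable D (EFin \o (fun x => f x + h x)).
Proof. by move=> i1 i2; apply: (integrableD _ i1 i2). Qed.

Lemma integrable_EFinB (f h : R -> R) : mu.-integrable D (EFin \o f) ->
  mu.-integrable D (EFin \o h) -> mu.-integrable D (EFin \o (fun x => f x - h x)).
Proof. by move=> i1 i2; apply: (integrableB _ i1 i2). Qed.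

(** An iterate is a finite linear combination of its terminal values, so integration over g passes
    inside. *)
Lemma chain_iter_Rintegral (F : R -> nat -> R) (w : R -> R) (k j a : nat) :
  (forall b, mu.-integrable D (EFin \o (fun g => F g b * w g))) ->
  mu.-integrable D (EFin \o (fun g => chain_iter d k j (F g) a * w g)) /\
  \int[mu]_(g in D) (chain_iter d k j (F g) a * w g) =
  chain_iter d k j (fun b => \int[mu]_(g in D) (F g b * w g)) a.
Proof.
move=> iF; elim: j k a => [|j IH] k a //=.
have [i1 e1] := IH k.+1 a; have [i2 e2] := IH k.+1 a.+1.
have E : (fun g => chain_step d k (chain_iter d k.+1 j (F g)) a * w g) =
   (fun g => miss_prob R d k a * (chain_iter d k.+1 j (F g) a * w g) +
   (1 - miss_prob R d k a) * (chain_iter d k.+1 j (F g) a.+1 * w g)).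
  by apply/funext => g; rewrite /chain_step; ring.
have z1 := integrable_EFinZ (miss_prob R d k a) i1.
have z2 := integrable_EFinZ (1 - miss_prob R d k a) i2.
have mD : measurable D by [].
rewrite E; split; first exact: integrable_EFinD.
by rewrite RintegralD// !RintegralZl// e1 e2.
Qed.

Variable p : nat.
Hypothesis p_gt : (e < p)%N.
Let r : R := p%:R / e%:R.

Let r1 : 1 < r.
Proof. by rewrite ltr_pdivlMr ?ltr0n// mul1r ltr_nat. Qed.

(** The factor exp(g) in the Laplace function cancels the exponential of the density. This leaves
    g^(r-1) exp (- g b^-e), with integral Gamma(r) b^(e r), and e r = p. For a >= n both sides
    vanish. *)
Lemma laplace_mixture (n a : nat) : (0 < n)%N ->
  mu.-integrable D (EFin \o (fun g => laplace e g n a * gamma_density r g)) /\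
  \int[mu]_(g in D) (laplace e g n a * gamma_density r g) =
  Gamma r * ((n - a)%:R / n%:R) ^+ p.
Proof.
move=> n0.
have [an|na] := ltnP a n; last first.
  have E : (fun g => laplace e g n a * gamma_density r g) = cst 0.
    by apply/funext => g; rewrite /laplace ltnNge na/= mul0r.
  rewrite E; split; first exact: integrable0.
  have -> : (n - a = 0)%N by apply/eqP; rewrite subn_eq0.
  by rewrite mul0r expr0n gtn_eqF ?(leq_trans _ p_gt)// mulr0 Rintegral_cst// mul0r.
have Bp : 0 < (n - a)%:R :> R by rewrite ltr0n subn_gt0.
have np : 0 < n%:R :> R by rewrite ltr0n.
set b := (n - a)%:R / n%:R.
have b0 : 0 < b by rewrite divr_gt0.
pose v := b ^- e.
have v0 : 0 < v by rewrite invr_gt0 exprn_gt0.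
have v1 : 1 <= v.
  by rewrite invf_ge1 ?exprn_gt0// exprn_ile1// ?(ltW b0)// ler_pdivrMr// mul1r ler_nat leq_subr.
have E : (fun g => laplace e g n a * gamma_density r g) =
    (fun g => g `^ (r - 1) * expR (- (v * g))).
  apply/funext => g; rewrite /laplace an /gamma_density mulrCA -expRD; congr (_ * expR _).
  rewrite (_ : n%:R / (n - a)%:R = b^-1); last by rewrite /b invf_div.
  by rewrite exprVn -/v; ring.
rewrite E; split.
  apply: le_integrable (integrable_gamma_density (ltW r1)) => //.
    apply/measurable_EFinP; apply: measurable_funTS.
    apply: measurable_funM; first exact: measurable_powR.
    by apply: measurableT_comp => //; apply: measurableT_comp => //.
  move=> g /=; rewrite in_itv/= andbT => g0.
  rewrite lee_fin !ger0_norm ?gamma_density_ge0//; last by rewrite mulr_ge0 ?powR_ge0 ?expR_ge0.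
  by rewrite ler_wpM2l ?powR_ge0// ler_expR lerN2 ler_peMl// (ltW g0).
rewrite Gamma_scale// mulrC; congr (_ * _).
rewrite /v -powR_invn ?(ltW b0)// -powRrM /r -powR_mulrn ?(ltW b0)//; congr (_ `^ _).
by field; rewrite pnatr_eq0 -lt0n.
Qed.

(** E b^p; for p = d this is the probability that vertex n+1 does not reach m. *)
Definition miss_mean (n m : nat) : R :=
  chain_iter d m (n - m) (fun a => ((n - a)%:R / n%:R) ^+ p) 1.

Lemma scaled_sum_mixture (n : nat) : (0 < n)%N ->
  mu.-integrable D (EFin \o (fun g => scaled_sum e g n * gamma_density r g)) /\
  \int[mu]_(g in D) (scaled_sum e g n * gamma_density r g) =
  Gamma r * (n%:R `^ (- alpha) * \sum_(m < n) (1 - miss_mean n m.+1)).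
Proof.
move=> n0.
have iG := integrable_gamma_density (ltW r1).
have mD : measurable D by [].
have im (m : nat) : mu.-integrable D (EFin \o (fun g => (1 - laplace_mean e g n m) * gamma_density r g))
   /\ \int[mu]_(g in D) ((1 - laplace_mean e g n m) * gamma_density r g) =
     Gamma r * (1 - miss_mean n m).
  have [i1 e1] := @chain_iter_Rintegral (fun g => laplace e g n) (gamma_density r) m (n - m) 1
    (fun b => (laplace_mixture b n0).1).
  have E : (fun g => (1 - laplace_mean e g n m) * gamma_density r g) =
     (fun g => gamma_density r g - chain_iter d m (n - m) (laplace e g n) 1 * gamma_density r g).
    by apply/funext => g; rewrite mulrBl mul1r.
  rewrite E; split.
    exact: integrable_EFinB.
  rewrite RintegralB// e1 mulrBr mulr1; congr (_ - _).
  rewrite -chain_iterZ; apply: eq_chain_iter => b.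
  exact: (laplace_mixture b n0).2.
have sums (N : nat) : mu.-integrable D (EFin \o (fun g => \sum_(m < N) ((1 - laplace_mean e g n m.+1) * gamma_density r g)))
  /\ \int[mu]_(g in D) (\sum_(m < N) ((1 - laplace_mean e g n m.+1) * gamma_density r g)) =
    \sum_(m < N) (Gamma r * (1 - miss_mean n m.+1)).
  elim: N => [|N [iN eN]].
    have -> : (fun g => \sum_(m < 0) ((1 - laplace_mean e g n m.+1) * gamma_density r g)) = cst 0.
      by apply/funext => g; rewrite big_ord0.
    by rewrite big_ord0; split; [exact: integrable0|rewrite Rintegral_cst// mul0r].
  have [i1 e1] := im N.+1.
  have -> : (fun g => \sum_(m < N.+1) ((1 - laplace_mean e g n m.+1) * gamma_density r g)) =
      (fun g => \sum_(m < N) ((1 - laplace_mean e g n m.+1) * gamma_density r g) +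
        (1 - laplace_mean e g n N.+1) * gamma_density r g).
    by apply/funext => g; rewrite big_ord_recr.
  split; first exact: integrable_EFinD.
  by rewrite big_ord_recr/= -eN -e1 -RintegralD.
have [iN eN] := sums n.
have E : (fun g => scaled_sum e g n * gamma_density r g) =
  (fun g => n%:R `^ (- alpha) * \sum_(m < n) ((1 - laplace_mean e g n m.+1) * gamma_density r g)).
  by apply/funext => g; rewrite /scaled_sum -mulrA -mulr_suml.
rewrite E; split; first exact: integrable_EFinZ.
by rewrite RintegralZl// eN -mulr_sumr mulrCA.
Qed.

(** For each g > 0 the scaled sums tend to a multiple of g^(1/d), which shifts the parameter of the
    Gamma density from r to r + 1/d. The bound linear in g dominates them. *)
Lemma miss_sum_cvg :
  n%:R `^ (- alpha) * (\sum_(m < n) (1 - miss_mean n m.+1)) @[n --> \oo] -->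
  e%:R `^ d%:R^-1 * I * (Gamma (r + d%:R^-1) / Gamma r).
Proof.
have G0 := Gamma_gt0 (ltW r1).
have I0 := root_integral_gt0 R d_gt1.
have mD : measurable D by [].
pose c : R := e%:R `^ d%:R^-1 * I.
have dV : 0 < d%:R^-1 :> R by rewrite invr_gt0.
have r2 : 1 <= r + d%:R^-1 by rewrite ler_wpDr// ltW.
have lim : (\int[mu]_(g in D) ((scaled_sum e g n * gamma_density r g)%:E) @[n --> \oo] -->
   \int[mu]_(g in D) ((c * gamma_density (r + d%:R^-1) g)%:E))%E.
  pose K : R := 2 * I * ((e%:R + curve_const R e)).
  apply: (@dominated_cvg _ _ _ mu D mD _ _
    (fun g => (K * gamma_density (r + 1) g + 4 * I * gamma_density r g)%:E)).
  - move=> [|n].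
      have -> : (fun g => (scaled_sum e g 0 * gamma_density r g)%:E) = cst 0%:E.
        by apply/funext => g; rewrite /scaled_sum big_ord0 mulr0 mul0r.
      exact: measurable_cst.
    by have [/measurable_int] := scaled_sum_mixture (isT : (0 < n.+1)%N).
  - move=> g /=; rewrite in_itv/= andbT => g0.
    have -> : c * gamma_density (r + d%:R^-1) g = (g * e%:R) `^ d%:R^-1 * I * gamma_density r g.
      rewrite /c /gamma_density powRM ?(ltW g0)// addrAC (@powRD _ g (r - 1)); last first.
        by rewrite (gt_eqF g0) implybT.
      by ring.
    apply: cvg_EFin; first by apply: nearW.
    by apply: cvgMr_tmp; exact: scaled_sum_cvg.
  - by [].
  - by apply: integrable_EFinD; apply: integrable_EFinZ; apply: integrable_gamma_density;
      rewrite ?(ltW r1)// lerDr ltW// (lt_trans ltr01).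
  - move=> n g /=; rewrite in_itv/= andbT => g0.
    have f0 : 0 <= scaled_sum e g n * gamma_density r g.
      by apply: mulr_ge0; [apply: scaled_sum_ge0; exact: ltW|exact: gamma_density_ge0].
    rewrite lee_fin (ger0_norm f0).
    have -> : K * gamma_density (r + 1) g + 4 * I * gamma_density r g =
        2 * I * ((e%:R + curve_const R e) * g + 2) * gamma_density r g.
      rewrite /K {1}/gamma_density addrAC (@powRD _ g (r - 1) 1); last by rewrite (gt_eqF g0) implybT.
      by rewrite powRr1 ?(ltW g0)// /gamma_density; ring.
    rewrite ler_wpM2r ?gamma_density_ge0//.
    have ub0 : 0 <= 2 * I * ((e%:R + curve_const R e) * g + 2).
      apply: mulr_ge0; first by rewrite mulr_ge0// ltW.
      apply: addr_ge0 => //; apply: mulr_ge0; last exact: ltW.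
      by rewrite addr_ge0// curve_const_ge0.
    case: n {f0} => [|n]; first by rewrite /scaled_sum big_ord0 mulr0.
    exact: scaled_sum_ub (ltW g0) _.
have limE : (\int[mu]_(g in D) ((c * gamma_density (r + d%:R^-1) g)%:E) =
    (c * Gamma (r + d%:R^-1))%:E)%E.
  rewrite -[in RHS]RintegralZl//; last exact: integrable_gamma_density.
  rewrite [in RHS]/Rintegral fineK//; apply: integrable_fin_num => //.
  exact: (integrable_EFinZ _ (integrable_gamma_density r2)).
rewrite limE in lim.
have {}lim := fine_cvg lim.
have {lim} : (Gamma r)^-1 * fine (\int[mu]_(g in D) ((scaled_sum e g n * gamma_density r g)%:E))%E @[n --> \oo]
    --> (Gamma r)^-1 * (c * Gamma (r + d%:R^-1)).
  by apply: cvgMl_tmp; exact: lim.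
have -> : (Gamma r)^-1 * (c * Gamma (r + d%:R^-1)) =
   e%:R `^ d%:R^-1 * I * (Gamma (r + d%:R^-1) / Gamma r) by rewrite /c; ring.
apply: cvg_trans; apply: near_eq_cvg; near=> n.
have n0 : (0 < n)%N by near: n; exact: nbhs_infty_gt.
have [_] := scaled_sum_mixture n0; rewrite /Rintegral => ->.
by rewrite /= mulKf// gt_eqF.
Unshelve. all: by end_near.
Qed.

End Mixture.

(** * From the random graph to the chain *)

Section Reaches.
Variable d : nat.
Implicit Types g : nat -> 'I_d -> nat.

Lemma reachesE g i j :
  reaches g i j <-> i = j \/ (2 <= i)%N /\ exists l, reaches g (g i l) j.
Proof.
split.
  move=> [[|x p]] /=; first by move=> _ ->; left.
  move=> /andP[/andP[i2 /existsP[l /eqP gx]] xp] lx; right; split => //.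
  by exists l; rewrite gx; exists p.
move=> [->|[i2 [l [p gp lp]]]]; first by exists [::].
exists (g i l :: p) => //=; rewrite gp andbT /arrow i2/=.
by apply/existsP; exists l.
Qed.

Lemma reaches_le g i j : (forall x l, (2 <= x)%N -> (g x l <= x.-1)%N) ->
  reaches g i j -> (j <= i)%N.
Proof.
move=> g_lt; elim/ltn_ind: i => i IH /reachesE[->//|[i2 [l /IH h]]].
have gi : (g i l < i)%N by apply: leq_ltn_trans (g_lt i l i2) _; rewrite prednK// ltnW.
by apply: leq_trans (h gi) (ltnW gi).
Qed.

(** Arrows point downwards, so a path from i <= k uses only rows up to k. *)
Lemma eq_reaches g g' k i j : (forall x l, (2 <= x)%N -> (g x l <= x.-1)%N) ->
  (forall x l, (2 <= x <= k)%N -> g x l = g' x l) -> (i <= k)%N ->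
  reaches g i j <-> reaches g' i j.
Proof.
move=> g_lt gg; elim/ltn_ind: i => i IH ik.
have gi l : (2 <= i)%N -> (g i l < i)%N.
  by move=> i2; apply: leq_ltn_trans (g_lt i l i2) _; rewrite prednK// ltnW.
split => /reachesE[->|[i2 [l h]]]; apply/reachesE; [by left| |by left|].
  right; split => //; exists l; rewrite -gg ?i2//; apply/IH => //; first exact: gi.
  by rewrite (leq_trans _ ik)// ltnW// gi.
right; split => //; exists l; apply/IH => //; first exact: gi.
  by rewrite (leq_trans _ ik)// ltnW// gi.
by rewrite gg ?i2.
Qed.

End Reaches.

(** * Events cut along a map to a finite type *)

Section FinitePartition.
Context (dT : measure_display) (T : measurableType dT) (R : realType) (P : probability T R).

Lemma fine_probabilityK (A : set T) : measurable A -> (fine (P A))%:E = P A.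
Proof. by move=> mA; rewrite fineK// fin_num_measure. Qed.

Lemma probability_bigsetU (I : choiceType) (F : I -> set T) (s : seq I) :
  (forall i, measurable (F i)) -> trivIset setT F -> uniq s ->
  P (\big[setU/set0]_(i <- s) F i) = (\sum_(i <- s) P (F i))%E.
Proof.
move=> mF tF; elim: s => [|i s IH /= /andP[iNs us]]; first by rewrite !big_nil measure0.
have mU : measurable (\big[setU/set0]_(j <- s) F j).
  by apply: bigsetU_measurable => j _; exact: mF.
rewrite !big_cons measureU//; first by congr (_ + _)%E; exact: IH.
apply/seteqP; split => // t [Fi]; rewrite -bigcup_seq => -[j /= js Fj].
have ij : i = j by apply: tF => //; exists t.
by rewrite ij js in iNs.
Qed.

(** Measurability of [A] is part of the conclusion: this is how reachability events, defined by the
    existence of a path, become measurable. *)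
Lemma probability_fiber_sum (C : finType) (f : T -> C) (A : set T) :
  (forall c, measurable (A `&` f @^-1` [set c])) ->
  measurable A /\ fine (P A) = \sum_(c : C) fine (P (A `&` f @^-1` [set c])).
Proof.
move=> mA.
have AE : A = \big[setU/set0]_(c : C) (A `&` f @^-1` [set c]).
  apply/seteqP; split => [t At|t].
    by rewrite -bigcup_seq; exists (f t) => //=; rewrite mem_index_enum.
  by rewrite -bigcup_seq => -[c _ []].
have tr : trivIset setT (fun c => A `&` f @^-1` [set c]).
  by move=> c c' _ _ [t [[_ <-] [_ <-]]].
have mA' : measurable A by rewrite AE; apply: bigsetU_measurable => c _; exact: mA.
split => //; apply: EFin_inj; rewrite fine_probabilityK//.
rewrite {1}AE probability_bigsetU ?index_enum_uniq//.
rewrite -sumEFin; apply: eq_bigr => c _.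
by rewrite fine_probabilityK.
Qed.

End FinitePartition.

(** * Independence of a new vertex from the past *)

Section RandomDag.
Context (dT : measure_display) (T : measurableType dT) (R : realType) (P : probability T R).
Variables (d : nat) (X : nat * 'I_d -> {RV P >-> nat}).
Hypothesis HX : random_recursive_dag X.

Let g (t : T) (j : nat) (l : 'I_d) : nat := X (j, l) t.

Let g_lt t x l : (2 <= x)%N -> (g t x l <= x.-1)%N.
Proof. by move=> x2; have /andP[] := target_range HX l t x2. Qed.

Variable k : nat.
Hypothesis k_gt0 : (0 < k)%N.
Notation config := {ffun 'I_k.+1 * 'I_d -> 'I_k.+1}.

(* The hypotheses say nothing about the rows 0 and 1, which no arrow uses: they
   are replaced by a constant. *)
Definition configuration (t : T) : config :=
  [ffun q : 'I_k.+1 * 'I_d => if (2 <= q.1)%N then inord (X (nat_of_ord q.1, q.2) t) else ord0].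

Lemma measurable_preimage_nat jl (B : set nat) : measurable (X jl @^-1` B).
Proof. exact: measurable_funPTI. Qed.

Lemma measurable_configuration c : measurable (configuration @^-1` [set c]).
Proof.
have -> : configuration @^-1` [set c] = \big[setI/setT]_(q : 'I_k.+1 * 'I_d)
    (if (2 <= q.1)%N then X (nat_of_ord q.1, q.2) @^-1` [set x | inord x = c q]
     else [set t | ord0 = c q]).
  rewrite -bigcap_seq; apply/seteqP; split => [t /= <- q _|t h].
    by case: ifP => q2; rewrite /= ffunE q2.
  apply/ffunP => q; have := h q; rewrite /= mem_index_enum => /(_ isT).
  by rewrite ffunE; case: ifP.
apply: bigsetI_measurable => q _; case: ifP => _.
  exact: measurable_preimage_nat.
have [->|/eqP cq] := eqVneq (ord0 : 'I_k.+1) (c q).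
  by rewrite (_ : [set _ | _] = setT)//; apply/seteqP; split.
by rewrite (_ : [set _ | _] = set0)//; apply/seteqP; split => // t /= /cq.
Qed.

Definition next_row (V : set nat) : set T := \bigcap_(l in [set: 'I_d]) (X (k.+1, l) @^-1` V).

(** Independence is given for finite families of single arrows. Both events are intersections over
    such families, with disjoint index sets [J] (rows 2 to k) and [K] (row k+1), and the product
    over the union splits. *)
Lemma configuration_next_row (c : config) (V : set nat) :
  P (configuration @^-1` [set c] `&` next_row V) =
  (P (configuration @^-1` [set c]) * P (next_row V))%E.
Proof.
(* A configuration with a nonzero entry in row 0 or 1 is never attained. *)
have [valid|] := boolP [forall q : 'I_k.+1 * 'I_d, (2 <= q.1)%N || (c q == ord0)]; last first.
  rewrite negb_forall => /existsP[q]; rewrite negb_or => /andP[q2 /eqP cq].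
  have -> : configuration @^-1` [set c] = set0.
    apply/seteqP; split => // t /= ct; apply: cq.
    by rewrite -ct ffunE (negbTE q2).
  by rewrite set0I measure0 mul0e.
pose J := [fset (nat_of_ord q.1, q.2) | q in [pred q : 'I_k.+1 * 'I_d | (2 <= q.1)%N]]%fset.
pose K := [fset (k.+1, l) | l in 'I_d]%fset.
pose B (p : nat * 'I_d) : set nat := if p.1 == k.+1 then V else [set x | inord x = c (inord p.1, p.2)].
have JE : configuration @^-1` [set c] = \bigcap_(p in [set` J]) (X p @^-1` B p).
  apply/seteqP; split => [t /= ct p|t h].
    move=> /imfsetP[/= q q2 ->]; have {}q2 : (2 <= q.1)%N := q2.
    by rewrite /B/= ltn_eqF//= inord_val -surjective_pairing -ct ffunE q2.
  apply/ffunP => q; rewrite ffunE; case: ifP => q2; last first.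
    by have /forallP/(_ q) := valid; rewrite q2/= => /eqP.
  have := h (nat_of_ord q.1, q.2); rewrite /B/= ltn_eqF//= inord_val -surjective_pairing.
  by apply; apply/imfsetP; exists q => //=; rewrite inE.
have KE : next_row V = \bigcap_(p in [set` K]) (X p @^-1` B p).
  apply/seteqP; split => [t h p /imfsetP[/= l _ ->]|t h l _].
    by rewrite /B/= eqxx; exact: h.
  by have := h (k.+1, l); rewrite /B/= eqxx; apply; apply/imfsetP; exists l.
have JK : configuration @^-1` [set c] `&` next_row V =
   \bigcap_(p in [set` (J `|` K)%fset]) (X p @^-1` B p).
  rewrite JE KE -bigcap_setU; congr (\bigcap_(_ in _) _).
  by apply/seteqP; split => p /=; rewrite inE; [move=> [->//|->]; rewrite orbT|move=> /orP].
have mB p : measurable (B p) by [].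
have J2 : [set` J] `<=` [set jk | (2 <= jk.1)%N].
  by move=> p /imfsetP[/= q q2 ->].
have K2 : [set` K] `<=` [set jk | (2 <= jk.1)%N].
  by move=> p /imfsetP[/= l _ ->].
have ind := target_independent HX.
rewrite JK JE KE !ind//; last first.
  by move=> p /=; rewrite inE => /orP[/J2|/K2].
rewrite (big_fsetID _ (fun p => p.1 != k.+1)) /=.
have Jk p : p \in J -> p.1 != k.+1.
  by move=> /imfsetP[/= q _ ->]/=; rewrite ltn_eqF.
have Kk p : p \in K -> p.1 == k.+1.
  by move=> /imfsetP[/= l _ ->]/=.
congr (_ * _)%E; apply: eq_fbigl => p; rewrite !inE/=.
  apply/andP/idP => [[/orP[//|/Kk ->//]]|pJ].
  by rewrite pJ Jk.
apply/andP/idP => [[/orP[/Jk ->//|//]]|pK].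
by rewrite pK orbT negbK Kk.
Qed.

Lemma probability_next_row (V : set nat) : P (next_row V) =
  (\prod_(l < d) P (X (k.+1, l) @^-1` V))%E.
Proof.
pose K := [fset (k.+1, l) | l in 'I_d]%fset.
have KE : next_row V = \bigcap_(p in [set` K]) (X p @^-1` V).
  apply/seteqP; split => [t h p /imfsetP[/= l _ ->]|t h l _]; first exact: h.
  by apply: (h (k.+1, l)); apply/imfsetP; exists l.
rewrite KE (target_independent HX) => [|p /imfsetP[/= l _ ->]//|//].
rewrite big_imfset/=; last by move=> l l' _ _ [].
by rewrite big_enum.
Qed.

Lemma measurable_next_row V : measurable (next_row V).
Proof.
apply: fin_bigcap_measurable => // l _; exact: measurable_preimage_nat.
Qed.

(** The targets in S are exclusive, each of probability 1/k. The index 0 must be excluded: the law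
    is uniform on [k], while ['I_k.+1] starts at 0. *)
Lemma next_row_miss (S : {set 'I_k.+1}) : ord0 \notin S ->
  P (next_row [set x | forall i, i \in S -> x <> nat_of_ord i]) = (miss_prob R d k #|S|)%:E.
Proof.
move=> S0; rewrite probability_next_row.
rewrite (eq_bigr (fun=> (1 - #|S|%:R / k%:R)%:E)) => [|l _].
  by rewrite prodEFin prodr_const card_ord.
pose f := X (k.+1, l).
have -> : f @^-1` [set x | forall i, i \in S -> x <> nat_of_ord i] =
   ~` \big[setU/set0]_(i <- enum S) (f @^-1` [set nat_of_ord i]).
  apply/seteqP; split => t; rewrite -bigcup_seq.
    by move=> h [i /=]; rewrite mem_enum => iS /h; apply.
  by move=> h i iS fi; apply: h; exists i => //=; rewrite mem_enum.
rewrite probability_setC; last by apply: bigsetU_measurable => i _; exact: measurable_preimage_nat.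
rewrite probability_bigsetU ?enum_uniq//; last 2 first.
- by move=> i; exact: measurable_preimage_nat.
- by move=> i j _ _ [t [/= ti tj]]; apply: ord_inj; rewrite -ti -tj.
rewrite big_enum/= (eq_bigr (fun=> (k%:R^-1)%:E)) => [|i iS].
  by rewrite sumEFin sumr_const -EFinB -[_ *+ _]mulr_natl.
rewrite (target_uniform HX)//.
apply/andP; split; last by rewrite -ltnS ltn_ord.
rewrite lt0n; apply: contraNneq S0 => i0.
by rewrite (_ : ord0 = i)//; exact: val_inj.
Qed.

Variable m : nat.
Hypothesis m_gt0 : (0 < m)%N.
Hypothesis m_le : (m <= k)%N.

Definition ancestor (t : T) (i : nat) : bool := `[< reaches (fun j l => X (j, l) t) i m >].

Definition ancestors (t : T) : {set 'I_k.+1} := [set i : 'I_k.+1 | ancestor t i].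

Lemma ancestors_configuration t t' : configuration t = configuration t' ->
  ancestors t = ancestors t'.
Proof.
move=> tt'; apply/setP => i; rewrite !inE; apply: asbool_equiv_eq.
apply: (@eq_reaches d _ _ k) => [x l|x l /andP[x2 xk]|]; [exact: g_lt| |by rewrite -ltnS].
have /ffunP/(_ (inord x, l)) := tt'; rewrite !ffunE/= inordK ?ltnS// x2.
move=> /(congr1 (@nat_of_ord _)).
have lt s : (X (x, l) s < k.+1)%N.
  by apply: leq_ltn_trans (g_lt s l x2) _; rewrite ltnS (leq_trans _ xk)// leq_pred.
by rewrite !inordK.
Qed.

Lemma ancestor0 t : ancestor t 0 = false.
Proof.
apply/asboolP => /reachesE[m0|[]//].
by have := m_gt0; rewrite -m0.
Qed.

Lemma ancestor_next t : ancestor t k.+1 = [exists l, inord (X (k.+1, l) t) \in ancestors t].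
Proof.
have lt l : (X (k.+1, l) t < k.+1)%N by exact: leq_ltn_trans (g_lt t l _) _.
apply/asboolP/existsP => [/reachesE[km|[_ [l h]]]|[l]].
- by have := m_le; rewrite -km ltnn.
- by exists l; rewrite inE inordK//; exact/asboolP.
rewrite inE inordK// => /asboolP h; apply/reachesE; right; split => //.
by exists l.
Qed.

(** An event about the ancestors in [k] is a finite union of fibres of [configuration], hence
    measurable and independent of the arrows of vertex k+1. *)
Lemma ancestors_next_row (b : pred {set 'I_k.+1}) (V : set nat) :
  measurable [set t | b (ancestors t)] /\
  fine (P ([set t | b (ancestors t)] `&` next_row V)) =
  fine (P [set t | b (ancestors t)]) * fine (P (next_row V)).
Proof.
pose A := [set t | b (ancestors t)].
have Ac c : A `&` configuration @^-1` [set c] = configuration @^-1` [set c] \/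
    A `&` configuration @^-1` [set c] = set0.
  have [[t [At ct]]|no] := pselect (exists t, (A `&` configuration @^-1` [set c]) t); [left|right].
    apply/seteqP; split => [u []//|u cu]; split => //.
    by rewrite /A/= (@ancestors_configuration u t)//= cu ct.
  by apply/seteqP; split => // t h; case: no; exists t.
have mH := measurable_next_row V.
have mAc c : measurable (A `&` configuration @^-1` [set c]).
  by case: (Ac c) => ->; [exact: measurable_configuration|exact: measurable0].
have [mA eA] := probability_fiber_sum P mAc.
split => //; rewrite -/A.
have mAH c : measurable ((A `&` next_row V) `&` configuration @^-1` [set c]).
  by rewrite setIAC; exact: measurableI.
have [_ ->] := probability_fiber_sum P mAH.
rewrite eA mulr_suml; apply: eq_bigr => c _.
rewrite setIAC -fineM ?fin_num_measure//.
by case: (Ac c) => ->; [rewrite configuration_next_row|rewrite set0I measure0 mul0e].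
Qed.

(** Conditioned on the whole ancestor set, the next row faces a fixed set of size [a]. The predicate
    may prescribe more than the size: the pair event also requires the last vertex to be an
    ancestor. *)
Lemma ancestors_miss (b : pred {set 'I_k.+1}) (a : nat) :
  (forall S, b S -> #|S| = a) ->
  fine (P ([set t | b (ancestors t)] `&` [set t | ~~ ancestor t k.+1])) =
  fine (P [set t | b (ancestors t)]) * miss_prob R d k a.
Proof.
move=> ba.
pose A := [set t | b (ancestors t)].
pose H (S : {set 'I_k.+1}) := next_row [set x | forall i, i \in S -> x <> nat_of_ord i].
have AS S : A `&` [set t | ~~ ancestor t k.+1] `&` ancestors @^-1` [set S] =
    [set t | (b S && (ancestors t == S))] `&` H S.
  apply/seteqP; split => t /=.
    move=> [[At nt] tS]; rewrite -tS eqxx andbT; split => // l _ i iS /= xi.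
    move/negP: nt; apply; rewrite ancestor_next; apply/existsP; exists l.
    by rewrite xi inord_val.
  move=> [/andP[bS /eqP tS] h]; split => //; split; first by rewrite /A/= tS.
  rewrite ancestor_next; apply/existsPn => l; apply/negP; rewrite tS => lS.
  apply: (h l I _ lS); rewrite inordK//.
  exact: leq_ltn_trans (g_lt t l _) _.
have mAS S : measurable [set t | (b S && (ancestors t == S))].
  by have [] := ancestors_next_row (fun S' => b S && (S' == S)) setT.
have m1 S : measurable (A `&` [set t | ~~ ancestor t k.+1] `&` ancestors @^-1` [set S]).
  by rewrite AS; apply: measurableI => //; exact: measurable_next_row.
have m2 S : measurable (A `&` ancestors @^-1` [set S]).
  have -> : A `&` ancestors @^-1` [set S] = [set t | (b S && (ancestors t == S))].
    apply/seteqP; split => t /=; first by move=> [At tS]; rewrite -tS eqxx andbT.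
    by move=> /andP[bS /eqP tS]; split => //; rewrite /A/= tS.
  exact: mAS.
have [_ ->] := probability_fiber_sum P m1.
have [_ ->] := probability_fiber_sum P m2.
rewrite mulr_suml; apply: eq_bigr => S _.
rewrite AS.
have [_ ->] := ancestors_next_row (fun S' => b S && (S' == S)) [set x | forall i, i \in S -> x <> nat_of_ord i].
have -> : A `&` ancestors @^-1` [set S] = [set t | (b S && (ancestors t == S))].
  apply/seteqP; split => t /=; first by move=> [At tS]; rewrite -tS eqxx andbT.
  by move=> /andP[bS /eqP tS]; split => //; rewrite /A/= tS.
have [bS|nbS] := boolP (b S); last first.
  by rewrite (_ : [set t | _] = set0) ?measure0 ?mul0r//; apply/seteqP; split.
have [S0|S0] := boolP (ord0 \in S).
  rewrite (_ : [set t | _] = set0) ?measure0 ?mul0r//; apply/seteqP; split => // t /= /eqP tS.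
  by move: S0; rewrite -tS inE ancestor0.
by rewrite next_row_miss// (ba S bS).
Qed.

End RandomDag.

(** * The ancestor count follows the chain *)

Section AncestorChain.
Context (dT : measure_display) (T : measurableType dT) (R : realType) (P : probability T R).
Variables (d : nat) (X : nat * 'I_d -> {RV P >-> nat}).
Hypothesis HX : random_recursive_dag X.
Variable m : nat.
Hypothesis m_gt0 : (0 < m)%N.

Notation anc := (ancestor X m).
Definition ancestor_count (k : nat) (t : T) : nat := #|ancestors X k m t|.

Lemma ancestor_countE k t : ancestor_count k t = (\sum_(i < k.+1) anc t i)%N.
Proof.
rewrite /ancestor_count -sum1_card big_mkcond; apply: eq_bigr => i _.
by rewrite inE; case: (anc t i).
Qed.

Lemma ancestor_countS k t : ancestor_count k.+1 t = (ancestor_count k t + anc t k.+1)%N.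
Proof. by rewrite !ancestor_countE big_ord_recr. Qed.

Lemma ancestor_lt i t : (i < m)%N -> anc t i = false.
Proof.
move=> im; apply/asboolP => h; have : (m <= i)%N; last by rewrite leqNgt im.
apply: reaches_le h => x l x2.
by have /andP[] := target_range HX l t x2.
Qed.

Lemma ancestor_count_m t : ancestor_count m t = 1%N.
Proof.
rewrite ancestor_countE big_ord_recr/= big1 => [|i _]; last by rewrite ancestor_lt.
rewrite add0n (_ : anc t m = true)//; apply/asboolP; apply/reachesE; by left.
Qed.

Lemma ancestor_count_le k t : (ancestor_count k t < k.+2)%N.
Proof. by rewrite ltnS (leq_trans (max_card _))// card_ord. Qed.

Definition mass (k a : nat) : R := fine (P [set t | ancestor_count k t == a]).

Lemma measurable_ancestors_pred k (b : pred {set 'I_k.+1}) : (0 < k)%N ->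
  measurable [set t | b (ancestors X k m t)].
Proof. by move=> k0; have [] := ancestors_next_row HX k0 m b setT. Qed.

Lemma mem_ancestors k t : (ord_max \in ancestors X k m t) = anc t k.
Proof. by rewrite inE. Qed.

Lemma measurable_ancestor k : (0 < k)%N -> measurable [set t | anc t k].
Proof.
move=> k0; have := measurable_ancestors_pred (fun S => ord_max \in S) k0.
by under eq_set do rewrite mem_ancestors.
Qed.

Lemma measurable_ancestor_count k a : (0 < k)%N -> measurable [set t | ancestor_count k t == a].
Proof. by move=> k0; exact: (measurable_ancestors_pred (fun S => #|S| == a)). Qed.

Lemma fine_probabilityDI (A B : set T) : measurable A -> measurable B ->
  fine (P A) = fine (P (A `&` ~` B)) + fine (P (A `&` B)).
Proof.
move=> mA mB; have mB' := measurableC mB.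
by rewrite (measureDI P mA mB) setDE fineD ?fin_num_measure//; exact: measurableI.
Qed.

Section Step.
Variable k : nat.
Hypothesis mk : (m <= k)%N.
Let k_gt0 : (0 < k)%N. Proof. exact: leq_trans mk. Qed.

Lemma setC_ancestor : ~` [set t | anc t k.+1] = [set t | ~~ anc t k.+1].
Proof. by apply/seteqP; split => t /negP. Qed.

Lemma ancestors_hit (b : pred {set 'I_k.+1}) (a : nat) :
  (forall S, b S -> #|S| = a) ->
  fine (P ([set t | b (ancestors X k m t)] `&` [set t | anc t k.+1])) =
  fine (P [set t | b (ancestors X k m t)]) * (1 - miss_prob R d k a).
Proof.
move=> ba; rewrite mulrBr mulr1 -(ancestors_miss HX k_gt0 m_gt0 mk ba).
rewrite (fine_probabilityDI (measurable_ancestors_pred b k_gt0) (measurable_ancestor (isT : 0 < k.+1)%N)).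
by rewrite setC_ancestor addrAC subrr add0r.
Qed.

(** Forward equation: the count [a] is kept by a miss or reached from a - 1 by a hit. *)
Lemma massS (a : nat) :
  mass k.+1 a = mass k a * miss_prob R d k a +
    (if a is a'.+1 then mass k a' * (1 - miss_prob R d k a') else 0).
Proof.
rewrite {1}/mass (fine_probabilityDI (measurable_ancestor_count a _) (measurable_ancestor (isT : 0 < k.+1)%N))//.
congr (_ + _).
  rewrite -(@ancestors_miss _ _ _ _ _ _ HX k k_gt0 m m_gt0 mk (fun S => #|S| == a)); last by move=> S /eqP.
  congr (fine (P _)); rewrite setC_ancestor; apply/seteqP; split => t /= [].
    by rewrite ancestor_countS => + nt; rewrite (negbTE nt) addn0.
  by rewrite ancestor_countS => + nt; rewrite (negbTE nt) addn0.
case: a => [|a].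
  rewrite (_ : _ `&` _ = set0) ?measure0//; apply/seteqP; split => // t /= [].
  by rewrite ancestor_countS => + ht; rewrite ht addn1.
rewrite -(@ancestors_hit (fun S => #|S| == a)); last by move=> S /eqP.
congr (fine (P _)); apply/seteqP; split => t /= [].
  by rewrite ancestor_countS => + ht; rewrite ht addn1.
by rewrite ancestor_countS => + ht; rewrite ht addn1.
Qed.

End Step.

Lemma mass_gt k a : (k.+1 < a)%N -> mass k a = 0.
Proof.
move=> ka; rewrite /mass (_ : [set t | _] = set0) ?measure0//.
apply/seteqP; split => // t /= /eqP h.
by have := ancestor_count_le k t; rewrite h ltnS leqNgt ka.
Qed.

(** The sum includes k + 1, the size of ['I_k.+1], which is the a priori bound on the count. *)
Definition mass_mean (k : nat) (f : nat -> R) : R := \sum_(a < k.+2) mass k a * f a.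

Lemma mass_meanS k f : (m <= k)%N -> mass_mean k.+1 f = mass_mean k (chain_step d k f).
Proof.
move=> mk; rewrite /mass_mean big_ord_recl/= massS// addr0.
under eq_bigr do rewrite massS//= mulrDl.
rewrite big_split/= addrA.
have -> : mass k 0 * miss_prob R d k 0 * f 0%N +
    \sum_(i < k.+2) mass k i.+1 * miss_prob R d k i.+1 * f i.+1 =
    \sum_(i < k.+2) mass k i * miss_prob R d k i * f i.
  rewrite -[LHS](big_ord_recl k.+2 (fun i => mass k i * miss_prob R d k i * f i)).
  by rewrite big_ord_recr/= mass_gt// !mul0r addr0.
rewrite -big_split/=; apply: eq_bigr => a _.
by rewrite /chain_step; ring.
Qed.

Lemma mass_meanE j f : mass_mean (m + j) f = chain_iter d m j f 1.
Proof.
elim: j f => [|j IH] f; last first.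
  rewrite addnS mass_meanS ?leq_addr// IH.
  (* The last step has been peeled off, whereas [chain_iter] unrolls the first. *)
  by rewrite -[in RHS](addn1 j) chain_iterD.
rewrite addn0 /mass_mean /= (bigD1 (Ordinal (isT : (1 < m.+2)%N)))//= big1 => [|a a1].
  rewrite /mass (_ : [set t | _] = setT); last by apply/seteqP; split => t //=; rewrite ancestor_count_m.
  by rewrite probability_setT mul1r addr0.
rewrite /mass (_ : [set t | _] = set0) ?measure0 ?mul0r//.
apply/seteqP; split => // t /=; rewrite ancestor_count_m => /eqP h.
by move: a1; rewrite -(inj_eq val_inj)/= -h.
Qed.

Definition pair_event (n : nat) : set T := [set t | anc t n && anc t n.+1].

Lemma measurable_pair_event n : (0 < n)%N -> measurable (pair_event n).
Proof.
move=> n0; rewrite /pair_event.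
have -> : [set t | anc t n && anc t n.+1] = [set t | anc t n] `&` [set t | anc t n.+1].
  by apply/seteqP; split => t /= /andP.
by apply: measurableI; exact: measurable_ancestor.
Qed.

(** The event is split by the ancestor count at n = m + j + 1. As n is itself an ancestor, this
    count is one more than at time n - 1; the two hits give the two factors. *)
Lemma probability_pair_event j :
  fine (P (pair_event (m + j).+1)) = chain_iter d m j
    (fun a => (1 - miss_prob R d (m + j) a) * (1 - miss_prob R d (m + j).+1 a.+1)) 1.
Proof.
rewrite -mass_meanE /mass_mean; set k := (m + j)%N.
have mk : (m <= k)%N by exact: leq_addr.
have k0 : (0 < k)%N by exact: leq_trans mk.
have m1 := measurable_pair_event (isT : (0 < k.+1)%N).
pose f t : 'I_k.+3 := inord (ancestor_count k.+1 t).
have fE a : pair_event k.+1 `&` f @^-1` [set a] =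
    [set t | (#|ancestors X k.+1 m t| == a) && (ord_max \in ancestors X k.+1 m t)] `&` [set t | anc t k.+2].
  apply/seteqP; split => t /=.
    move=> [/andP[h1 h2] <-]; rewrite mem_ancestors; split => //.
    by rewrite h1 andbT /f inordK// ancestor_count_le.
  rewrite mem_ancestors => -[/andP[/eqP ca h1] h2]; split; first by rewrite /pair_event/= h1.
  by apply: val_inj; rewrite /f/= inordK ?ancestor_count_le.
have mfE a : measurable (pair_event k.+1 `&` f @^-1` [set a]).
  rewrite fE; apply: measurableI; last exact: measurable_ancestor.
  exact: (measurable_ancestors_pred (fun S => (#|S| == a) && (ord_max \in S))).
have [_ ->] := probability_fiber_sum P mfE.
have hit a : fine (P (pair_event k.+1 `&` f @^-1` [set a])) =
    (if nat_of_ord a is a'.+1 then mass k a' * (1 - miss_prob R d k a') else 0) * (1 - miss_prob R d k.+1 a).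
  rewrite fE (@ancestors_hit k.+1 _ (fun S => (#|S| == a) && (ord_max \in S)) a) ?(leqW mk)//; last first.
    by move=> S /andP[/eqP].
  congr (_ * _).
  have -> : [set t | (#|ancestors X k.+1 m t| == a) && (ord_max \in ancestors X k.+1 m t)] =
     [set t | ancestor_count k.+1 t == a] `&` [set t | anc t k.+1].
    by apply/seteqP; split => t /=; rewrite mem_ancestors => /andP.
  case: (nat_of_ord a) => [|a'].
    rewrite (_ : _ `&` _ = set0) ?measure0//; apply/seteqP; split => // t /= [].
    by rewrite ancestor_countS => + ht; rewrite ht addn1.
  rewrite -(@ancestors_hit k mk (fun S => #|S| == a')); last by move=> S /eqP.
  congr (fine (P _)); apply/seteqP; split => t /= [].
    by rewrite ancestor_countS => + ht; rewrite ht addn1.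
  by rewrite ancestor_countS => + ht; rewrite ht addn1.
rewrite (eq_bigr _ (fun a _ => hit a)) big_ord_recl/= mul0r add0r.
by apply: eq_bigr => a _; rewrite mulrA.
Qed.

End AncestorChain.

(** * The limit *)

Section PairMean.
Variables (R : realType) (d : nat).

(* The probability that both n and n+1 reach m (for m < n): given that n is a
   hit, n+1 is drawn among n vertices of which a+1 reach m. *)
Definition pair_mean (n m : nat) : R := chain_iter d m (n.-1 - m)
  (fun a => (1 - miss_prob R d n.-1 a) * (1 - miss_prob R d n a.+1)) 1.

Lemma expr_lipschitz (x y : R) : 0 <= x <= 1 -> 0 <= y <= 1 ->
  `|x ^+ d - y ^+ d| <= d%:R * `|x - y|.
Proof.
wlog yx : x y / y <= x.
  move=> H hx hy; have [xy|xy] := leP y x; first exact: H.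
  by rewrite distrC (distrC x); apply: H => //; exact: ltW.
move=> /andP[x0 x1] /andP[y0 y1].
rewrite !ger0_norm ?subr_ge0// ?lerXn2r//.
by apply: exprB_le => //; rewrite y0.
Qed.

(** If the three miss probabilities [M], [N], [K] were equal, the two terms would agree. They differ
    pairwise by O(d/n), and the identities in the proof isolate these differences: one D from the
    first summand, three from the second. *)
Lemma pair_step_error (n a : nat) : (0 < n)%N -> (a <= n)%N ->
  `|(1 - miss_prob R d n a) * (1 - miss_prob R d n.+1 a.+1)
    - chain_step d n (fun b => (1 - miss_prob R d n.+1 b) ^+ 2) a| <= 4 * (d%:R / n.+1%:R).
Proof.
move=> n0 an.
have np : 0 < n%:R :> R by rewrite ltr0n.
have np1 : 0 < n.+1%:R :> R by [].
have /andP[r0 r1] := @ratio_bounds R n a n0 an.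
have /andP[s0 s1] := @ratio_bounds R n.+1 a isT (leqW an).
have an1 : (a.+1 <= n.+1)%N by [].
have /andP[u0 u1] := @ratio_bounds R n.+1 a.+1 isT an1.
have /andP[M0 M1] := @miss_prob_bounds R d n a n0 an.
have /andP[N0 N1] := @miss_prob_bounds R d n.+1 a isT (leqW an).
have /andP[K0 K1] := @miss_prob_bounds R d n.+1 a.+1 isT an1.
have rs : a%:R / n%:R - a%:R / n.+1%:R = a%:R / n%:R / n.+1%:R :> R.
  by rewrite -[n.+1%:R]natr1 in np1 *; field; rewrite !gt_eqF.
have ru : a.+1%:R / n.+1%:R = a%:R / n.+1%:R + n.+1%:R^-1 :> R.
  by rewrite -natr1 mulrDl mul1r.
have V0 : 0 < n.+1%:R^-1 :> R by rewrite invr_gt0.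
have q0 : 0 <= (a%:R / n%:R / n.+1%:R : R) <= n.+1%:R^-1.
  by rewrite mulr_ge0 ?(ltW V0)//= ler_piMl// ltW.
have d1' : `|1 - a%:R / n%:R - (1 - a%:R / n.+1%:R)| <= n.+1%:R^-1 :> R.
  move: n.+1%:R^-1 (a%:R / n.+1%:R) (a%:R / n%:R) (a%:R / n%:R / n.+1%:R) rs V0 q0 => V s r q rs V0 /andP[q1 q2].
  by rewrite ler_norml; apply/andP; split; lra.
have d2' : `|1 - a%:R / n%:R - (1 - a.+1%:R / n.+1%:R)| <= n.+1%:R^-1 :> R.
  move: n.+1%:R^-1 (a.+1%:R / n.+1%:R) (a%:R / n.+1%:R) (a%:R / n%:R) (a%:R / n%:R / n.+1%:R) rs ru V0 q0 => V u s r q rs ru V0 /andP[q1 q2].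
  by rewrite ler_norml; apply/andP; split; lra.
have d1 : `|miss_prob R d n a - miss_prob R d n.+1 a| <= d%:R / n.+1%:R.
  apply: le_trans (expr_lipschitz _ _) _; rewrite ?subr_ge0 ?r1 ?s1 ?gerBl//.
  by rewrite ler_wpM2l.
have d2 : `|miss_prob R d n a - miss_prob R d n.+1 a.+1| <= d%:R / n.+1%:R.
  apply: le_trans (expr_lipschitz _ _) _; rewrite ?subr_ge0 ?r1 ?u1 ?gerBl//.
  by rewrite ler_wpM2l.
move: M0 M1 N0 N1 K0 K1 d1 d2; rewrite /chain_step.
set M := miss_prob R d n a; set N := miss_prob R d n.+1 a; set K := miss_prob R d n.+1 a.+1.
set D := d%:R / _ => M0 M1 N0 N1 K0 K1 d1 d2.
have -> : (1 - M) * (1 - K) - (M * (1 - N) ^+ 2 + (1 - M) * (1 - K) ^+ 2) =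
  (1 - M) * (1 - K) * (K - M) + M * ((1 - M) * (1 - K) - (1 - N) ^+ 2) by ring.
have -> : (1 - M) * (1 - K) - (1 - N) ^+ 2 = (1 - K) * (N - M) + (1 - N) * (N - K) by ring.
have nk : `|N - K| <= 2 * D.
  have -> : N - K = (M - K) - (M - N) by ring.
  by apply: le_trans (ler_normB _ _) _; lra.
have prodle (x y E : R) : 0 <= x <= 1 -> `|y| <= E -> `|x * y| <= E.
  move=> /andP[x0 x1] yE; rewrite normrM (ger0_norm x0); apply: le_trans yE.
  by rewrite ler_piMl.
have M01 : 0 <= M <= 1 by rewrite M0.
have b1 : `|(1 - M) * (1 - K) * (K - M)| <= D.
  apply: prodle; last by rewrite distrC.
  by rewrite mulr_ge0 ?subr_ge0//= mulr_ile1 ?subr_ge0 ?gerBl.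
have b2 : `|(1 - K) * (N - M)| <= D.
  by apply: prodle; [rewrite subr_ge0 K1 gerBl|rewrite distrC].
have b3 : `|(1 - N) * (N - K)| <= 2 * D.
  by apply: prodle => //; rewrite subr_ge0 N1 gerBl.
have b4 : `|(1 - K) * (N - M) + (1 - N) * (N - K)| <= D + 2 * D.
  by apply: le_trans (ler_normD _ _) _; exact: lerD.
have b5 := prodle _ _ _ M01 b4.
by apply: le_trans (ler_normD _ _) _; lra.
Qed.

End PairMean.

(** * Convergence of the scaled sum *)

Section Limit.
Variables (R : realType) (e : nat).
Hypothesis e_gt0 : (0 < e)%N.
Let d := e.+1.
Let alpha : R := (d%:R - 1) / d%:R.

Definition square_mean (n m : nat) : R :=
  chain_iter d m (n - m) (fun b => (1 - miss_prob R d n b) ^+ 2) 1.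

(** (1 - f)^2 = 2 (1 - f) - (1 - f^2). With f = b^d, both parts are complements of moments of b,
    whose sums over m are of order n^alpha, unlike the sum of the constant 1. *)
Lemma chain_iter_sqr1B (f : nat -> R) (k j a : nat) :
  chain_iter d k j (fun b => (1 - f b) ^+ 2) a =
  2 * (1 - chain_iter d k j f a) - (1 - chain_iter d k j (fun b => f b ^+ 2) a).
Proof.
elim: j k a => [|j IH] k a /=; first by ring.
by rewrite /chain_step !IH; ring.
Qed.

Lemma square_meanE (n m : nat) : (0 < m)%N -> (m <= n)%N ->
  square_mean n m = 2 * (1 - miss_mean R e d n m) - (1 - miss_mean R e (2 * d) n m).
Proof.
move=> m0 mn; have n0 : (0 < n)%N by apply: leq_trans mn.
have mmE p : miss_mean R e p n m = chain_iter d m (n - m) (fun a => (1 - a%:R / n%:R) ^+ p) 1.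
  (* The subtraction n - a is truncated and matches 1 - a/n only for a <= n, so the functions are
     compared on reachable states. *)
  have E (f g : nat -> R) : (forall b, (1 <= b <= m + (n - m))%N -> f b = g b) ->
      chain_iter d m (n - m) f 1 = chain_iter d m (n - m) g 1.
    by move=> fg; apply/eqP; rewrite eq_le !chain_iter_le// => b /fg ->.
  apply: E => b /andP[_]; rewrite subnKC// => bn.
  by rewrite natrB// mulrBl divff// pnatr_eq0 -lt0n.
rewrite !mmE /square_mean.
have -> : chain_iter d m (n - m) (fun a => (1 - a%:R / n%:R) ^+ (2 * d)) 1 =
    chain_iter d m (n - m) (fun a => miss_prob R d n a ^+ 2) 1.
  by apply: eq_chain_iter => a; rewrite /miss_prob mulnC exprM.
rewrite -[fun a => (1 - a%:R / n%:R) ^+ d]/(miss_prob R d n).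
exact: chain_iter_sqr1B.
Qed.

Lemma square_mean_bounds (n m : nat) : (0 < m)%N -> (m <= n)%N -> 0 <= square_mean n m <= 1.
Proof.
move=> m0 mn; have n0 : (0 < n)%N by apply: leq_trans mn.
have b01 b : (1 <= b <= m + (n - m))%N -> 0 <= (1 - miss_prob R d n b) ^+ 2 <= 1.
  move=> /andP[_]; rewrite subnKC// => bn.
  have /andP[h0 h1] := @miss_prob_bounds R d n b n0 bn.
  by rewrite sqr_ge0 expr_le1 ?subr_ge0// gerBl.
apply/andP; split.
  rewrite -[leLHS](@chain_iter_cst R d m (n - m) 0 1).
  by apply: chain_iter_le => // b /b01/andP[].
rewrite -[leRHS](@chain_iter_cst R d m (n - m) 1 1).
by apply: chain_iter_le => // b /b01/andP[].
Qed.

(** [square_mean] runs one step longer than [pair_mean]; conditioning at time n - 1 reduces the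
    comparison to a single step. *)
Lemma pair_mean_error (n m : nat) : (0 < m)%N -> (m < n)%N ->
  `|pair_mean R d n m - square_mean n m| <= 4 * (d%:R / n%:R).
Proof.
case: n => [//|n] m0 mn; rewrite ltnS in mn.
have n0 : (0 < n)%N by apply: leq_trans mn.
rewrite /pair_mean /square_mean /= subSn// -[(n - m).+1]addn1 chain_iterD/= subnKC//.
rewrite -chain_iter_sub -[leRHS](@chain_iter_cst R d m (n - m) _ 1).
apply: chain_iter_norm => // b /andP[_]; rewrite subnKC// => bn.
exact: pair_step_error.
Qed.

Lemma square_sum_cvg :
  n%:R `^ (- alpha) * (\sum_(m < n) square_mean n m.+1) @[n --> \oo] -->
  e%:R `^ d%:R^-1 * @root_integral R d *
   (2 * (Gamma (d%:R / e%:R + d%:R^-1) / Gamma (d%:R / e%:R : R)) -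
    Gamma ((2 * d)%:R / e%:R + d%:R^-1) / Gamma ((2 * d)%:R / e%:R : R)).
Proof.
have c1 := @miss_sum_cvg R e e_gt0 d (ltnSn e).
have e2 : (e < 2 * d)%N by rewrite mul2n -addnn ltn_addr.
have c2 := @miss_sum_cvg R e e_gt0 (2 * d)%N e2.
set K := _ * @root_integral R d; set A := Gamma _ / _; set B := Gamma _ / Gamma ((2 * d)%:R / _).
have -> : K * (2 * A - Gamma ((2 * d)%:R / e%:R + d%:R^-1) / Gamma ((2 * d)%:R / e%:R : R)) =
   2 * (K * A) - K * B by rewrite /B; ring.
have c : 2 * (n%:R `^ (- alpha) * (\sum_(m < n) (1 - miss_mean R e d n m.+1))) -
  n%:R `^ (- alpha) * (\sum_(m < n) (1 - miss_mean R e (2 * d) n m.+1)) @[n --> \oo] -->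
   2 * (K * A) - K * B.
  by apply: cvgB; [apply: cvgMl_tmp; exact: c1|exact: c2].
apply: cvg_trans c; apply: near_eq_cvg; near=> n.
rewrite /= mulrCA -mulrBr; congr (_ * _).
rewrite mulr_sumr -sumrB; apply: eq_bigr => m _.
by rewrite square_meanE.
Unshelve. all: by end_near.
Qed.

(** The total error stays bounded while the scale is n^alpha. The target n escapes the formula, as
    its chain would start after time n - 1; its term costs the 1 in 4 d + 1. *)
Lemma pair_sum_cvg (p : nat -> nat -> R) :
  (forall n m, (m < n)%N -> 0 <= p n m <= 1) ->
  (forall n m, (m.+1 < n)%N -> p n m = pair_mean R d n m.+1) ->
  n%:R `^ (- alpha) * (\sum_(m < n) p n m) @[n --> \oo] -->
  e%:R `^ d%:R^-1 * @root_integral R d *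
   (2 * (Gamma (d%:R / e%:R + d%:R^-1) / Gamma (d%:R / e%:R : R)) -
    Gamma ((2 * d)%:R / e%:R + d%:R^-1) / Gamma ((2 * d)%:R / e%:R : R)).
Proof.
move=> p01 pE.
suff : n%:R `^ (- alpha) * (\sum_(m < n) p n m) - n%:R `^ (- alpha) * (\sum_(m < n) square_mean n m.+1)
     @[n --> \oo] --> 0.
  move=> /cvgD /(_ square_sum_cvg); rewrite add0r.
  by under eq_cvg do rewrite /= subrK.
have a0 : 0 < alpha by apply: alpha_gt0; rewrite /d ltnS.
have C0 : (4 * d%:R + 1) * n%:R `^ (- alpha) @[n --> \oo] --> (0 : R).
  by rewrite -[X in _ --> X](mulr0 (4 * d%:R + 1)); apply: cvgMl_tmp; exact: cvgn_powRN0.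
have bound n : `|\sum_(m < n) (p n m - square_mean n m.+1)| <= 4 * d%:R + 1.
  case: n => [|n]; first by rewrite big_ord0 normr0 addr_ge0.
  apply: le_trans (ler_norm_sum _ _ _) _.
  rewrite big_ord_recr/= lerD//; last first.
    have /andP[? ?] := p01 n.+1 n (ltnSn n).
    have /andP[? ?] := @square_mean_bounds n.+1 n.+1 isT (leqnn _).
    by rewrite ler_norml; apply/andP; split; lra.
  apply: (@le_trans _ _ (\sum_(m < n) 4 * (d%:R / n.+1%:R))).
    apply: ler_sum => m _; rewrite pE ?ltnS//.
    by apply: pair_mean_error; rewrite ?ltnS.
  rewrite sumr_const card_ord -[_ *+ n]mulr_natr -mulrA ler_wpM2l//.
  by rewrite -mulrA ler_piMr// mulrC ler_pdivrMr// mul1r ler_nat.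
apply/cvgr0Pnorm_le => eps eps0.
have hC := cvgr_le _ C0 _ eps0; near=> n.
have n0 : (0 < n)%N by near: n; exact: nbhs_infty_gt.
apply: (@le_trans _ _ ((4 * d%:R + 1) * n%:R `^ (- alpha))); last by near: n; exact: hC.
have np : 0 < n%:R :> R by rewrite ltr0n.
rewrite -mulrBr -sumrB normrM ger0_norm ?powR_ge0// mulrC ler_wpM2r ?powR_ge0//.
Unshelve. all: by end_near.
Qed.

End Limit.

(** * The expectation as a sum over targets *)

Section IntersectionMean.
Context (dT : measure_display) (T : measurableType dT) (R : realType) (P : probability T R).
Variables (d : nat) (X : nat * 'I_d -> {RV P >-> nat}).
Hypothesis HX : random_recursive_dag X.

(** Descendants of n lie in [n], so n+1 drops out and the indicators run over the targets 1, ...,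
    n. *)
Lemma card_descendants_cap (n : nat) (t : T) :
  #|` (descendants (fun j k => X (j, k) t) n `&` descendants (fun j k => X (j, k) t) n.+1)%fset|%:R
  = \sum_(m < n) \1_(pair_event X m.+1 n) t :> R.
Proof.
set D := (_ `&` _)%fset.
pose b j := ancestor X j t n && ancestor X j t n.+1.
have DE : perm_eq (enum_fset D) [seq j <- iota 1 n | b j].
  apply: uniq_perm; rewrite ?fset_uniq ?filter_uniq ?iota_uniq// => j.
  rewrite mem_filter -[j \in enum_fset D]/(j \in D) !inE/= !mem_iota.
  rewrite /b /ancestor add1n add2n.
  have -> : (j == 1%N) || (1 < j < n.+2)%N = (0 < j < n.+2)%N by case: j => [|[|j]].
  case: (leqP 1 j) => j1; rewrite /= ?andbF//.
  case: (ltnP j n.+1) => jn; rewrite ?andbF//= (leqW jn)/= ?andbT//.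
rewrite (perm_size DE) size_filter -sum1_count natr_sum.
rewrite big_mkcond.
rewrite -[iota 1 n](_ : index_iota 1 n.+1 = _); last by rewrite /index_iota subn1.
rewrite big_add1/= big_mkord; apply: eq_bigr => m _.
rewrite indicE /pair_event -/(b m.+1).
case: (boolP (b m.+1)) => bm.
  by rewrite mem_set.
by rewrite memNset//; exact/negP.
Qed.

Lemma expectation_descendants_cap (n : nat) : (0 < n)%N ->
  'E_P[fun t => #|` (descendants (fun j k => X (j, k) t) n `&`
      descendants (fun j k => X (j, k) t) n.+1)%fset|%:R]%E =
  (\sum_(m < n) fine (P (pair_event X m.+1 n)))%:E.
Proof.
move=> n0; under eq_fun do rewrite card_descendants_cap.
rewrite unlock -sumEFin.
under eq_integral do rewrite -sumEFin.
rewrite ge0_integral_sum//.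
- apply: eq_bigr => m _; rewrite integral_indic ?setIT//.
    by rewrite fineK// fin_num_measure//; exact: measurable_pair_event.
  exact: measurable_pair_event.
- move=> m; apply/measurable_EFinP; apply: measurable_indic.
  exact: measurable_pair_event.
Qed.

End IntersectionMean.

Unset Implicit Arguments.
Set Strict Implicit.

Theorem theorem2 (R : realType) (dT : measure_display)
    (T : measurableType dT) (P : probability T R) (d : nat)
    (X : nat * 'I_d -> {RV P >-> nat}) :
  (2 <= d)%N ->
  random_recursive_dag X ->
  let D (n : nat) (t : T) := descendants (fun j k => X (j, k) t) n in
  let e : R := d%:R in
  ((n%:R `^ (- ((e - 1) / e)))%:E *
     'E_P[fun t => #|` (D n t `&` D n.+1 t)%fset|%:R])%E @[n --> \oo] -->
  ((e - 1) `^ (1 / e) * pi / (e * sin (pi / e)) *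
     (2 * Gamma (e / (e - 1) + 1 / e) / Gamma (e / (e - 1)) -
      Gamma (2 * e / (e - 1) + 1 / e) / Gamma (2 * e / (e - 1))))%:E.
Proof.
(* From here on [e] is the natural number d - 1 and [e'] is the real number d. *)
case: d X => [//|e] X; rewrite ltnS => e0 HX D e'.
pose p n m : R := fine (P (pair_event X m.+1 n)).
have p01 n m : (m < n)%N -> 0 <= p n m <= 1.
  move=> mn; have mE := measurable_pair_event HX m.+1 (leq_ltn_trans (leq0n m) mn).
  by rewrite /p fine_ge0//= -lee_fin fineK ?fin_num_measure// probability_le1.
(* The condition m + 1 < n allows n to be written as (m + 1) + j + 1, the form in which the pair
   event is computed. *)
have pE n m : (m.+1 < n)%N -> p n m = pair_mean R e.+1 n m.+1.
  case: n => // n; rewrite ltnS => mn.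
  rewrite /p /pair_mean/= -{1}(subnKC mn).
  rewrite probability_pair_event//.
  by rewrite subnKC.
have lim := pair_sum_cvg e0 p01 pE.
have -> : (e' - 1) `^ (1 / e') * pi / (e' * sin (pi / e')) *
     (2 * Gamma (e' / (e' - 1) + 1 / e') / Gamma (e' / (e' - 1)) -
      Gamma (2 * e' / (e' - 1) + 1 / e') / Gamma (2 * e' / (e' - 1))) =
  e%:R `^ e.+1%:R^-1 * @root_integral R e.+1 *
   (2 * (Gamma (e.+1%:R / e%:R + e.+1%:R^-1) / Gamma (e.+1%:R / e%:R : R)) -
    Gamma ((2 * e.+1)%:R / e%:R + e.+1%:R^-1) / Gamma ((2 * e.+1)%:R / e%:R : R)).
  have e1 : e' - 1 = e%:R by rewrite /e' -natr1 addrK.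
  rewrite e1 /e' div1r natrM /root_integral !mulrA.
  by [].
set L := (X in X%:E).
have {}lim : (n%:R `^ (- ((e.+1%:R - 1) / e.+1%:R)) * \sum_(m < n) p n m)%:E @[n --> \oo] --> L%:E.
  by apply: cvg_EFin => //; exact: nearW.
apply: cvg_trans lim; apply: near_eq_cvg; near=> n.
rewrite expectation_descendants_cap// ?EFinM//.
by near: n; exact: nbhs_infty_gt.
Unshelve. all: by end_near.
Qed.
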